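(* Let $\Lambda$ be a block and let $D$ and $D'$ be stacked circle diagrams for $\Lambda$ such that $D'$ is obtained from $D$ by a surgery. Then the map $\mathrm{surg}_{D,D'}$ is (homogeneous) of degree zero.
   Context: **Weights and blocks.** A weight labels each vertex $i\in\mathbb Z_{>0}$ by one of $\times,\circ,\vee,\wedge$, almost all labels being $\circ$. A block $\Lambda$ is given by a block diagram $\Theta$ (a labelling of $\mathbb Z_{>0}$ by $\times,\circ,\diamond$, almost all $\circ$) and a parity: $\Lambda$ is the set of weights having $\times$, $\circ$ exactly where $\Theta$ has them, $\vee$ or $\wedge$ at the $\diamond$-positions, and number of $\wedge$'s of the given parity. $P$ is the set of $\diamond$-positions and $\mathrm p(i)=\#\{j\in P: j\le i\}$. **Cup diagrams.** A cup diagram $c$ (for $\Theta$) is a non-crossing collection of arcs drawn below the number line such that each point of $P$ lies on exactly one arc; an arc is a cup (joining two points of $P$) or a ray (going vertically down to infinity from a point of $P$). Each arc is dotted or undotted, where no dotted cup is nested inside another cup and no dotted cup or dotted ray lies to the right of a ray. Reflecting $c$ in the number line gives a cap diagram $c^*$. For $\lambda\in\Lambda$ the cup diagram $\underline\lambda$ is obtained so: connect successively neighbouring $\vee\wedge$ (ignoring already connected vertices and vertices not in $P$) by undotted cups as long as possible; attach undotted rays to the remaining $\vee$'s; connect the remaining $\wedge$'s in neighbouring pairs from left to right by dotted cups; if one $\wedge$ remains attach a dotted ray to it. Put $\overline\lambda=(\underline\lambda)^*$. **Stacked circle diagrams.** A stacked circle diagram of height $h\ge0$ for $\Lambda$ is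 $D=\underline\lambda(\mathbf a)\overline\mu$ with $\lambda,\mu\in\Lambda$ and $\mathbf a=(a_1,\dots,a_h)$ cup diagrams for $\Theta$. With $a_0=\underline\lambda$, $a_{h+1}^*=\overline\mu$, it is drawn by stacking the circle diagrams $a_la_{l+1}^*$, $0\le l\le h$, from bottom to top, the vertices of the $l$-th one being $(i,l)$, $i\in P$, and gluing the rays of $a_l$ with their mirror images in $a_l^*$ for $1\le l\le h$. An orientation is a sequence $\boldsymbol\nu=(\nu_0,\dots,\nu_h)\in\Lambda^{h+1}$ such that, with respect to $\nu_l$, each cup or cap of $a_la_{l+1}^*$ has end points labelled (left, right) $\vee\wedge$ (degree 0) or $\wedge\vee$ (degree 1) if undotted and $\wedge\wedge$ (degree 0) or $\vee\vee$ (degree 1) if dotted; undotted (resp. dotted) rays of $\underline\lambda$ and of $\overline\mu$ are labelled $\vee$ (resp. $\wedge$); and for each ray of $a_l$ ($1\le l\le h$) at $i$ the labels of $\nu_{l-1},\nu_l$ at $i$ agree. The degree of an oriented stacked circle diagram is the sum of the degrees of all its cups and caps. ${}_\lambda(\mathbb D^{\mathbf a}_\Lambda)_\mu$ is the graded complex vector space with basis the orientations $\underline\lambda(\mathbf a,\boldsymbol\nu)\overline\mu$ of $D$. Connected components are circles or lines; a line is propagating if one end is at the top and one at the bottom. An oriented circle is clockwise if the label at a vertex of it with maximal first coordinate is $\vee$ and anticlockwise if it is $\wedge$ (independent of the chosen such vertex); lines have only one orientation, called anticlockwise. For a vertex $v$ on a circle $C$ of an orientable $D$, $\mathrm{sign}_D(v)=(-1)^u$,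 $u$ the number of undotted cups and caps on a path of arcs in $C$ from $v$ to a vertex of $C$ with maximal first coordinate (independent of choices). **Surgery.** $D'=\underline\lambda(\mathbf b)\overline\mu$ is obtained from $D=\underline\lambda(\mathbf a)\overline\mu$ by a surgery at $i<j$ on level $l$ if $b_m=a_m$ for $m\ne l$ and the cup diagram $b_l$ is obtained from $a_l$ by replacing exactly one cup, joining $i$ and $j$, by two undotted rays. The map $\mathrm{surg}_{D,D'}:{}_\lambda(\mathbb D^{\mathbf a}_\Lambda)_\mu\to{}_\lambda(\mathbb D^{\mathbf b}_\Lambda)_\mu$ is $0$ if $D'$ is not orientable, and otherwise on basis vectors (components not involved keep their orientation): - Merge (the components $C_{l-1}\ni(i,l-1)$ and $C_l\ni(i,l)$ become one component $C$): both anticlockwise $\mapsto$ $C$ anticlockwise; exactly one, $C_r$ with $r\in\{l-1,l\}$, clockwise $\mapsto$ $\mathrm{sign}_D(i,r)\mathrm{sign}_{D'}(i,r)$ times $C$ clockwise ($0$ if $C$ is a line); both clockwise $\mapsto0$. - Split (one component $C$ becomes $C_i\ni(i,l)$ and $C_j\ni(j,l)$): $C$ anticlockwise $\mapsto(-1)^{\mathrm p(i)}\big(\mathrm{sign}_{D'}(j,l)[C_j\text{ clockwise},C_i\text{ anticlockwise}]+\epsilon\,\mathrm{sign}_{D'}(i,l)[C_i\text{ clockwise},C_j\text{ anticlockwise}]\big)$ with $\epsilon=1$ if the removed cup was dotted and $-1$ otherwise, terms with a clockwise line being $0$; $C$ clockwise $\mapsto(-1)^{\mathrm p(i)}\mathrm{sign}_D(i,l)\mathrm{sign}_{D'}(i,l)\mathrm{sign}_{D'}(j,l)[C_i,C_j\text{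 clockwise}]$. - Reconnect (two lines become two lines): the same $\boldsymbol\nu$ if it is an orientation of $D'$ and both lines in $D$ were propagating, and $0$ otherwise. *)

(* Defs.v *)
From HB Require Import structures.
From mathcomp Require Import all_boot all_order all_algebra.
From mathcomp Require Import finmap boolp reals complex.

Set Implicit Arguments.
Unset Strict Implicit.
Unset Printing Implicit Defensive.

Import GRing.Theory.
Local Open Scope ring_scope.

(** * Weights and blocks *)

Inductive blabel := BCross | BCirc | BDiamond.

(* [Down] is the label "vee" and [Up] is the label "wedge". *)
Inductive wlabel := Cross | Circ | Down | Up.

Definition blabel_code (x : blabel) : option bool :=
  match x with BCross => Some false | BCirc => Some true | BDiamond => None end.
Definition blabel_decode (k : option bool) : blabel :=
  match k with Some false => BCross | Some true => BCirc | None => BDiamond end.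
Lemma blabel_codeK : cancel blabel_code blabel_decode. Proof. by case. Qed.
HB.instance Definition _ := Countable.copy blabel (can_type blabel_codeK).
HB.instance Definition _ : isFinite blabel := CanIsFinite blabel_codeK.

Definition wlabel_code (x : wlabel) : bool * bool :=
  match x with
  | Cross => (false, false) | Circ => (false, true)
  | Down => (true, false) | Up => (true, true)
  end.
Definition wlabel_decode (k : bool * bool) : wlabel :=
  match k with
  | (false, false) => Cross | (false, true) => Circ
  | (true, false) => Down | (true, true) => Up
  end.
Lemma wlabel_codeK : cancel wlabel_code wlabel_decode. Proof. by case. Qed.
HB.instance Definition _ := Countable.copy wlabel (can_type wlabel_codeK).
HB.instance Definition _ : isFinite wlabel := CanIsFinite wlabel_codeK.

Definition position := {i : nat | (0 < i)%N}.

Definition weight := {fsfun position -> wlabel with Circ}.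
Definition block_diagram := {fsfun position -> blabel with BCirc}.

Definition base_label (x : wlabel) : blabel :=
  match x with Cross => BCross | Circ => BCirc | Down | Up => BDiamond end.

(* The set P of diamond positions, as a finite type. *)
Definition point (Th : block_diagram) : finType :=
  [fset i in finsupp Th | Th i == BDiamond]%fset.

Definition coord (Th : block_diagram) (i : point Th) : nat := val (val i).

(* The number p(i). *)
Definition rank_pt (Th : block_diagram) (i : point Th) : nat :=
  #|[set j : point Th | (coord j <= coord i)%N]|.

(* [odd_up] says whether the number of wedges has to be odd. *)
Record block := Block { theta :> block_diagram; odd_up : bool }.

Definition in_block (L : block) (lam : weight) : Prop :=
  (forall i : position, base_label (lam i) = theta L i) /\
  odd #|[set i : point L | lam (val i) == Up]| = odd_up L.

Definition block_weight (L : block) : Type :=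
  {lam : weight | `[< in_block L lam >]}.
HB.instance Definition _ (L : block) := Countable.on (block_weight L).

Definition wt_label (L : block) (lam : block_weight L) (i : point L) : wlabel :=
  val lam (val i).

(* A weight of the block is determined by its restriction to the support of the
   block diagram, so that [block_weight L] is a finite type. *)
Definition block_weight_code (L : block) (lam : block_weight L) :
  {ffun finsupp (theta L) -> wlabel} := [ffun i => val lam (val i)].
Definition block_weight_decode (L : block)
    (f : {ffun finsupp (theta L) -> wlabel}) : option (block_weight L) :=
  insub [fsfun i : finsupp (theta L) => f i | Circ].
Lemma block_weight_codeK (L : block) :
  pcancel (@block_weight_code L) (@block_weight_decode L).
Proof.
move=> lam; rewrite /block_weight_decode.
have -> : [fsfun i : finsupp (theta L) => block_weight_code lam i | Circ]
          = val lam :> weight; last exact: valK.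
apply/fsfunP => i; rewrite fsfun_ffun /=.
have /asboolP[Hlam _] := valP lam.
case: insubP => [u _ <-|] /=; first by rewrite ffunE.
rewrite mem_finsupp negbK => /eqP Hi.
by move: (Hlam i); rewrite Hi; case: (val lam i).
Qed.
HB.instance Definition _ (L : block) : isFinite (block_weight L) :=
  PCanIsFinite (@block_weight_codeK L).

(** * Cup diagrams *)

(* [Cup i j d] is the cup with left end [i] and right end [j]; the boolean of
   an arc says whether it is dotted. *)
Inductive diagram_arc (I : Type) := Cup of I & I & bool | Ray of I & bool.

Definition arc_code (I : Type) (a : diagram_arc I) :
    (I * I * bool + I * bool)%type :=
  match a with Cup i j d => inl (i, j, d) | Ray i d => inr (i, d) end.
Definition arc_decode (I : Type) (x : (I * I * bool + I * bool)%type) :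
    diagram_arc I :=
  match x with inl (i, j, d) => Cup i j d | inr (i, d) => Ray i d end.
Lemma arc_codeK (I : Type) : cancel (@arc_code I) (@arc_decode I).
Proof. by case. Qed.
HB.instance Definition _ (I : eqType) :=
  Equality.copy (diagram_arc I) (can_type (@arc_codeK I)).
HB.instance Definition _ (I : choiceType) :=
  Choice.copy (diagram_arc I) (can_type (@arc_codeK I)).
HB.instance Definition _ (I : countType) :=
  Countable.copy (diagram_arc I) (can_type (@arc_codeK I)).
HB.instance Definition _ (I : finType) : isFinite (diagram_arc I) :=
  CanIsFinite (@arc_codeK I).

Definition on_arc (I : eqType) (i : I) (a : diagram_arc I) : bool :=
  match a with Cup j k _ => (i == j) || (i == k) | Ray j _ => i == j end.

(* A ray goes down to infinity, so it crosses every cup it lies inside of. *)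
Record is_cup_diagram (Th : block_diagram)
    (c : {set diagram_arc (point Th)}) : Prop := IsCupDiagram {
  cup_left_right : forall i j d, Cup i j d \in c -> (coord i < coord j)%N;
  one_arc_per_point : forall i, #|[set a in c | on_arc i a]| = 1%N;
  cups_noncrossing : forall i j d k m e, Cup i j d \in c -> Cup k m e \in c ->
    ~~ [&& (coord i < coord k)%N, (coord k < coord j)%N
         & (coord j < coord m)%N];
  cup_ray_noncrossing : forall i j d k e, Cup i j d \in c -> Ray k e \in c ->
    ~~ ((coord i < coord k)%N && (coord k < coord j)%N);
  dotted_cup_not_nested : forall i j k m e,
    Cup i j true \in c -> Cup k m e \in c ->
    ~~ ((coord k < coord i)%N && (coord j < coord m)%N);
  dotted_cup_left_of_rays : forall i j k e,
    Cup i j true \in c -> Ray k e \in c -> ~~ (coord k < coord i)%N;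
  dotted_ray_left_of_rays : forall i k e,
    Ray i true \in c -> Ray k e \in c -> ~~ (coord k < coord i)%N }.

Record cup_diagram (Th : block_diagram) := CupDiagram {
  arcs_of :> {set diagram_arc (point Th)};
  cup_diagramP : is_cup_diagram arcs_of }.

(* The construction of the cup diagram of a weight, on the list of the points of
   P in increasing order; [down] tells the points labelled "vee" from those
   labelled "wedge". *)
Fixpoint first_vee_wedge (I : Type) (down : pred I) (s : seq I) :
    option (I * I) :=
  match s with
  | x :: ((y :: _) as s') =>
      if down x && ~~ down y then Some (x, y) else first_vee_wedge down s'
  | _ => None
  end.

(* The undotted cups and the list of the points that are not connected by them;
   [n] bounds the number of steps. *)
Fixpoint vee_wedge_cups (I : eqType) (down : pred I) (n : nat) (s : seq I) :
    seq (diagram_arc I) * seq I :=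
  if n is n'.+1 then
    if first_vee_wedge down s is Some (x, y) then
      let: (cs, r) := vee_wedge_cups down n' (rem x (rem y s)) in
      (Cup x y false :: cs, r)
    else ([::], s)
  else ([::], s).

Fixpoint dotted_arcs (I : Type) (s : seq I) : seq (diagram_arc I) :=
  match s with
  | x :: y :: s' => Cup x y true :: dotted_arcs s'
  | [:: x] => [:: Ray x true]
  | [::] => [::]
  end.

Definition arcs_of_labels (I : eqType) (down : pred I) (s : seq I) :
    seq (diagram_arc I) :=
  let: (cs, r) := vee_wedge_cups down (size s) s in
  cs ++ [seq Ray x false | x <- r & down x]
     ++ dotted_arcs [seq x <- r | ~~ down x].

Definition underline (L : block) (lam : block_weight L) :
    {set diagram_arc (point L)} :=
  [set a in arcs_of_labels (fun i => wt_label lam i == Down)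
              (sort (fun i j => (coord i <= coord j)%N) (enum (point L)))].

(** * Stacked circle diagrams *)

(* [st_mid l] is the cup diagram a_(l+1). *)
Record stacked (L : block) (h : nat) := Stacked {
  st_bot : block_weight L;
  st_mid : 'I_h -> cup_diagram L;
  st_top : block_weight L }.

(* The arcs of a_l, for l <= h + 1. Caps are not represented separately: the
   caps at level l are the mirror images of the cups of a_(l+1). *)
Definition layer (L : block) (h : nat) (D : stacked L h) (l : nat) :
    {set diagram_arc (point L)} :=
  if l is l'.+1 then
    if insub l' is Some m then arcs_of (st_mid D m) else underline (st_top D)
  else underline (st_bot D).

Definition vertex (L : block) (h : nat) : finType := (point L * 'I_h.+1)%type.

Definition has_cup (I : finType) (c : {set diagram_arc I}) (d : bool) (i j : I) :
    bool :=
  (Cup i j d \in c) || (Cup j i d \in c).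

Definition has_ray (I : finType) (c : {set diagram_arc I}) (i : I) : bool :=
  [exists d, Ray i d \in c].

Definition joined_by_cup (L : block) (h : nat) (D : stacked L h) (d : bool)
    (v w : vertex L h) : bool :=
  (v.2 == w.2) && (has_cup (layer D v.2) d v.1 w.1
                   || has_cup (layer D v.2.+1) d v.1 w.1).

Definition joined_by_rays (L : block) (h : nat) (D : stacked L h)
    (v w : vertex L h) : bool :=
  (v.1 == w.1) &&
  ((w.2 == v.2.+1 :> nat) && has_ray (layer D w.2) v.1
   || (v.2 == w.2.+1 :> nat) && has_ray (layer D v.2) v.1).

(* [step D u v w]: some arc joins [v] and [w] which is an undotted cup or cap if
   [u] is true, and a dotted cup or cap or a pair of glued rays otherwise. *)
Definition step (L : block) (h : nat) (D : stacked L h) (u : bool) :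
    rel (vertex L h) := fun v w =>
  if u then joined_by_cup D false v w
  else joined_by_cup D true v w || joined_by_rays D v w.

Definition same_comp (L : block) (h : nat) (D : stacked L h) :
    rel (vertex L h) :=
  connect (fun v w => step D true v w || step D false v w).

Definition at_bottom_ray (L : block) (h : nat) (D : stacked L h)
    (v : vertex L h) : bool :=
  (v.2 == 0%N :> nat) && has_ray (layer D 0) v.1.
Definition at_top_ray (L : block) (h : nat) (D : stacked L h)
    (v : vertex L h) : bool :=
  (v.2 == h :> nat) && has_ray (layer D h.+1) v.1.

(* A component is referred to by any of its vertices. *)
Definition on_line (L : block) (h : nat) (D : stacked L h) (v : vertex L h) :
    bool :=
  [exists w, same_comp D v w && (at_bottom_ray D w || at_top_ray D w)].
Definition on_circle (L : block) (h : nat) (D : stacked L h) (v : vertex L h) :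
    bool := ~~ on_line D v.
Definition on_propagating_line (L : block) (h : nat) (D : stacked L h)
    (v : vertex L h) : bool :=
  [exists w, same_comp D v w && at_bottom_ray D w] &&
  [exists w, same_comp D v w && at_top_ray D w].

(* [w] is a vertex with maximal first coordinate of the component of [v]. *)
Definition rightmost (L : block) (h : nat) (D : stacked L h)
    (v w : vertex L h) : bool :=
  same_comp D v w &&
  [forall u, same_comp D v u ==> (coord u.1 <= coord w.1)%N].

(* [path_parity D v w b]: some path of arcs from [v] to [w] has a number of
   undotted cups and caps that is odd if [b] is true and even otherwise. *)
Definition path_parity (L : block) (h : nat) (D : stacked L h)
    (v w : vertex L h) (b : bool) : bool :=
  connect (fun x y : vertex L h * bool => step D (x.2 (+) y.2) x.1 y.1)
          (v, false) (w, b).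

(* The parity of the path does not depend on choices if [v] lies on a circle and
   [D] is orientable, the only case in which this sign matters. *)
Definition sign (R : realType) (L : block) (h : nat) (D : stacked L h)
    (v : vertex L h) : R[i] :=
  (-1) ^+ [exists w, rightmost D v w && path_parity D v w true].

(** * Orientations *)

Definition cup_degree (d : bool) (left right : wlabel) : option nat :=
  match d, left, right with
  | false, Down, Up => Some 0%N
  | false, Up, Down => Some 1%N
  | true, Up, Up => Some 0%N
  | true, Down, Down => Some 1%N
  | _, _, _ => None
  end.

Record is_orientation (L : block) (h : nat) (D : stacked L h)
    (nu : {ffun 'I_h.+1 -> block_weight L}) : Prop := IsOrientation {
  oriented_cups : forall (l : 'I_h.+1) i j d, Cup i j d \in layer D l ->
    cup_degree d (wt_label (nu l) i) (wt_label (nu l) j) <> None;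
  oriented_caps : forall (l : 'I_h.+1) i j d, Cup i j d \in layer D l.+1 ->
    cup_degree d (wt_label (nu l) i) (wt_label (nu l) j) <> None;
  oriented_bottom_rays : forall i d, Ray i d \in layer D 0 ->
    wt_label (nu ord0) i = if d then Up else Down;
  oriented_top_rays : forall i d, Ray i d \in layer D h.+1 ->
    wt_label (nu ord_max) i = if d then Up else Down;
  oriented_glued_rays : forall (l m : 'I_h.+1) i,
    m = l.+1 :> nat -> has_ray (layer D m) i ->
    wt_label (nu l) i = wt_label (nu m) i }.

Definition orientation (L : block) (h : nat) (D : stacked L h) : finType :=
  {nu : {ffun 'I_h.+1 -> block_weight L} | `[< is_orientation D nu >]}.

Definition label (L : block) (h : nat) (D : stacked L h) (nu : orientation D)
    (v : vertex L h) : wlabel :=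
  wt_label (val nu v.2) v.1.

Definition arc_degree (L : block) (lam : block_weight L)
    (a : diagram_arc (point L)) : nat :=
  if a is Cup i j d then
    odflt 0%N (cup_degree d (wt_label lam i) (wt_label lam j))
  else 0%N.

Definition degree (L : block) (h : nat) (D : stacked L h) (nu : orientation D) :
    nat :=
  (\sum_(l < h.+1) (\sum_(a in layer D l) arc_degree (val nu l) a
                    + \sum_(a in layer D l.+1) arc_degree (val nu l) a))%N.

Definition clockwise (L : block) (h : nat) (D : stacked L h)
    (nu : orientation D) (v : vertex L h) : bool :=
  on_circle D v && [exists w, rightmost D v w && (label nu w == Down)].

Definition anticlockwise (L : block) (h : nat) (D : stacked L h)
    (nu : orientation D) (v : vertex L h) : bool :=
  on_line D v || [exists w, rightmost D v w && (label nu w == Up)].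

(* The complex vector space with basis the orientations of D. *)
Definition space (R : realType) (L : block) (h : nat) (D : stacked L h) :=
  {ffun orientation D -> R[i]^o}.

Definition homogeneous (R : realType) (L : block) (h : nat) (D : stacked L h)
    (d : nat) (x : space R D) : Prop :=
  forall nu : orientation D, x nu != 0 -> degree nu = d.

Definition homogeneous_of_degree_zero (R : realType) (L : block) (h : nat)
    (D D' : stacked L h) (f : {linear space R D -> space R D'}) : Prop :=
  forall (d : nat) (x : space R D), homogeneous d x -> homogeneous d (f x).

(** * Surgery *)

(* For [l : 'I_h] the surgery takes place on level l + 1, that is on the cup
   diagram a_(l+1), the vertices involved being those over [i] and [j] on the
   levels l and l + 1. *)
Definition is_surgery (L : block) (h : nat) (D D' : stacked L h)
    (l : 'I_h) (i j : point L) : Prop :=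
  [/\ st_bot D' = st_bot D, st_top D' = st_top D,
      (forall m, m != l -> arcs_of (st_mid D' m) = arcs_of (st_mid D m)),
      (coord i < coord j)%N
    & exists2 d : bool, Cup i j d \in arcs_of (st_mid D l) &
        arcs_of (st_mid D' l) = arcs_of (st_mid D l) :\ Cup i j d
                                :|: [set Ray i false; Ray j false]].

Definition below (L : block) (h : nat) (l : 'I_h) (i : point L) : vertex L h :=
  (i, widen_ord (leqnSn h) l).
Definition above (L : block) (h : nat) (l : 'I_h) (i : point L) : vertex L h :=
  (i, lift ord0 l).

(* The components not involved in the surgery keep their orientation. *)
Definition agree_off_surgery (L : block) (h : nat) (D D' : stacked L h)
    (l : 'I_h) (i : point L) (nu : orientation D) (nu' : orientation D') :
    bool :=
  [forall v, [|| same_comp D (below l i) v, same_comp D (above l i) v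
               | label nu' v == label nu v]].

Definition merge_coef (R : realType) (L : block) (h : nat) (D D' : stacked L h)
    (l : 'I_h) (i : point L) (nu : orientation D) (nu' : orientation D') :
    R[i] :=
  let u := below l i in
  let v := above l i in
  if anticlockwise nu u && anticlockwise nu v then
    (anticlockwise nu' v)%:R
  else if clockwise nu u && anticlockwise nu v then
    sign R D u * sign R D' u * (clockwise nu' v)%:R
  else if anticlockwise nu u && clockwise nu v then
    sign R D v * sign R D' v * (clockwise nu' v)%:R
  else 0.

Definition split_coef (R : realType) (L : block) (h : nat) (D D' : stacked L h)
    (l : 'I_h) (i j : point L) (nu : orientation D) (nu' : orientation D') :
    R[i] :=
  let v := above l i in
  let w := above l j in
  let eps : R[i] := if Cup i j true \in arcs_of (st_mid D l) then 1 else -1 in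
  (-1) ^+ rank_pt i *
  (if anticlockwise nu v then
     sign R D' w * (clockwise nu' w && anticlockwise nu' v)%:R
     + eps * sign R D' v * (clockwise nu' v && anticlockwise nu' w)%:R
   else if clockwise nu v then
     sign R D v * sign R D' v * sign R D' w
     * (clockwise nu' v && clockwise nu' w)%:R
   else 0).

Definition reconnect_coef (R : realType) (L : block) (h : nat)
    (D D' : stacked L h) (l : 'I_h) (i : point L)
    (nu : orientation D) (nu' : orientation D') : R[i] :=
  [&& val nu' == val nu, on_propagating_line D (below l i)
    & on_propagating_line D (above l i)]%:R.

(* The coefficient of the basis vector [nu'] in the image of the basis vector
   [nu]. *)
Definition surg_coef (R : realType) (L : block) (h : nat) (D D' : stacked L h)
    (l : 'I_h) (i j : point L) (nu : orientation D) (nu' : orientation D') :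
    R[i] :=
  if ~~ agree_off_surgery l i nu nu' then 0 else
  match same_comp D (below l i) (above l i),
        same_comp D' (above l i) (above l j) with
  | false, true => merge_coef R l i nu nu'
  | true, false => split_coef R l i j nu nu'
  | false, false => reconnect_coef R l i nu nu'
  | true, true => 0 (* impossible for a planar diagram *)
  end.

(* If D' is not orientable then [space R D'] is zero, and so is this map. *)
Definition surg (R : realType) (L : block) (h : nat) (D D' : stacked L h)
    (l : 'I_h) (i j : point L) (x : space R D) : space R D' :=
  \sum_(nu : orientation D)
     x nu *: ([ffun nu' => surg_coef R l i j nu nu'] : space R D').

Lemma surg_is_linear (R : realType) (L : block) (h : nat) (D D' : stacked L h)
    (l : 'I_h) (i j : point L) : linear (@surg R L h D D' l i j).
Proof.
move=> a x y; rewrite /surg scaler_sumr -big_split /=.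
by apply: eq_bigr => nu _; rewrite !ffunE scalerDl scalerA.
Qed.

HB.instance Definition _ (R : realType) (L : block) (h : nat)
    (D D' : stacked L h) (l : 'I_h) (i j : point L) :=
  GRing.isLinear.Build _ _ _ _ (@surg R L h D D' l i j)
    (@surg_is_linear R L h D D' l i j).

(* Main.v *)
Require Import Defs.
From mathcomp Require Import all_boot all_order all_algebra.
From mathcomp Require Import finmap boolp reals complex.
From mathcomp Require Import zify ring.
Import Defs.

Set Implicit Arguments.
Unset Strict Implicit.
Unset Printing Implicit Defensive.

Import Order.TTheory GRing.Theory Num.Theory.
Local Open Scope ring_scope.

(** An undotted or dotted cup or cap of an oriented diagram has degree 1 exactly
    when its right end is labelled vee. Give the label vee the spin 1 and the
    label wedge the spin -1, and let the value of a component be the sum, over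
    its cups and caps, of the spin of the right end. Then twice the degree is
    the number of cups and caps plus the sum of the values of the components
    ([degree_spin]). A surgery removes one cup and one cap and leaves all labels
    off the affected components alone. So it suffices that the affected
    components gain 2 in value whenever the coefficient is nonzero
    ([degree_surgery]).

    The values are known. A circle has twice the spin of any of its rightmost
    vertices, that is 2 if it is clockwise and -2 if it is anticlockwise
    ([circle_value]); a line has value 0 if it is propagating and 1 otherwise
    ([line_value]). Moreover a line has two ray ends and a circle has none, and
    a surgery neither creates nor destroys ray ends nor moves them out of the
    affected components. This settles merges and splits by arithmetic: two
    anticlockwise circles of total value -4 merge into one of value -2, and so
    on. In a reconnection the labels are kept, so that the value changes by the
    spins of the right ends of the removed cup and cap; these agree, and the
    values of lines are not negative, so the change from 0 is by 2.

    Both formulas for the value are cases of the theorem of Hopf on the rotation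
    of the tangent of a simple curve. The labels do not orient a component with
    dotted arcs, because the two ends of a dotted arc carry the same label. They
    do orient its lift to a double cover: reflect the number line in the origin,
    and let a dotted arc from i to j lift to an arc from i to -j. The rules
    about dots in a cup diagram ensure that the lifted arcs do not cross
    ([lifted_cups_noncrossing], [lifted_cup_ray_noncrossing]). Up to a sign, the
    value of a component is the rotation of the tangent of its lift, counted in
    half turns ([arrow_rotation]).

    The theorem of Hopf is proved for curves composed of cups, caps and vertical
    segments on a lattice. If two points move on a curve without crossings, the
    angle swept by the direction from one to the other is the same whichever of
    them moves first ([sweep_exchange]). Hence the rotation of the tangent, which
    is the angle swept when both points travel together, equals the angle swept
    by the curve as seen from its starting point, plus the same for its end
    point ([rotation_sum]). For a circle started at a rightmost vertex and for a
    line started at a ray end, these two angles are obvious ([closed_rotation],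
    [open_rotation]).

    The outermost layers of a stacked diagram are given by the construction of
    the cup diagram of a weight; that the result is a cup diagram is
    [underline_cup_diagram]. *)

(** * Rotation of lattice curves *)

(** The point of a curve with abscissa [px] on the level [py], passed upwards if
    the boolean is true and downwards otherwise. *)
Definition arrow : Type := (int * int * bool)%type.
Definition px (p : arrow) : int := p.1.1.
Definition py (p : arrow) : int := p.1.2.

(** Directions are divided into the upper half, including the direction to the
    right, and the lower half, including the direction to the left. When a point
    moves from [p] to [q] along the arc determined by their directions (a cap, a
    cup or a vertical segment), [sweep p q w] is 1 or -1 if the direction from
    [w] to this point passes from one half to the other, anticlockwise or
    clockwise, and 0 if it does not. The intervals are closed on one side so that
    this remains true for [w = p], where the direction starts as the tangent at
    [w], and for [w = q], where it ends as the opposite of the tangent. *)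
Definition sweep (p q w : arrow) : int :=
  match p.2, q.2 with
  | true, false =>
      if py w == py p then
        ((px q < px w) && (px w <= px p))%:Z
        - ((px p < px w) && (px w <= px q))%:Z
      else 0
  | false, true =>
      if py w == py p then
        ((px p <= px w) && (px w < px q))%:Z
        - ((px q <= px w) && (px w < px p))%:Z
      else 0
  | true, true =>
      ((py w == py q) && (px w < px p))%:Z
      - ((py w == py p) && (px p < px w))%:Z
  | false, false =>
      ((py w == py q) && (px p < px w))%:Z
      - ((py w == py p) && (px w < px p))%:Z
  end.

Definition is_step (p q : arrow) : bool :=
  match p.2, q.2 with
  | true, true => (px q == px p) && (py q == py p + 1)
  | false, false => (px q == px p) && (py q == py p - 1)
  | _, _ => (py q == py p) && (px q != px p)
  end.

Definition between (a b c : int) : bool :=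
  ((a < c) && (c < b)) || ((b < c) && (c < a)).

(** The layer between the levels [y - 1] and [y] has the number [y]; an arc lies
    above or below its starting point according to the direction in which it
    leaves. *)
Definition same_layer (p r : arrow) : bool := py p + p.2%:Z == py r + r.2%:Z.

Definition noncrossing (p q r s : arrow) : bool :=
  same_layer p r ==>
  match p.2 == q.2, r.2 == s.2 with
  | false, false => (p.2 == r.2) ==>
      (between (px p) (px q) (px r) == between (px p) (px q) (px s))
  | false, true => ~~ between (px p) (px q) (px r)
  | true, false => ~~ between (px r) (px s) (px p)
  | true, true => true
  end.

Definition apart (p q : arrow) : bool := (py p == py q) ==> (px p != px q).

(** The angle swept by the line through two points, moving from [p] to [q] and
    from [r] to [s], is the same for the two orders of moving them. *)
Definition exchangeable (p q r s : arrow) : Prop :=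
  sweep p q r + sweep r s q = sweep r s p + sweep p q s.

Ltac decide_atom :=
  match goal with
  | |- context[@eq_op _ ?a ?b] =>
      lazymatch type of a with bool => fail | _ => case: (ltgtP a b) => ? /= end
  | |- context[@Order.lt _ _ ?a ?b] => case: (ltgtP a b) => ? /=
  | |- context[@Order.le _ _ ?a ?b] => case: (ltgtP a b) => ? /=
  end; rewrite ?andbT ?andbF ?orbT ?orbF ?implybT /=; try done;
  try (exfalso; lia).

(** A difference would mean that one moving point had to cross the path of the
    other. *)
Lemma sweep_exchange (p q r s : arrow) :
  is_step p q -> is_step r s -> noncrossing p q r s ->
  apart p r -> apart q s -> q = r \/ apart q r -> s = p \/ apart s p ->
  exchangeable p q r s.
Proof.
have eqE (a b : arrow) : a = b -> [&& px a == px b, py a == py b & a.2 == b.2].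
  by move=> ->; rewrite !eqxx.
move=> H1 H2 H3 H4 H5 H6 H7.
have {}H6 : (q == r) || apart q r by case: H6 => [->|->]; rewrite ?eqxx ?orbT.
have {}H7 : (s == p) || apart s p by case: H7 => [->|->]; rewrite ?eqxx ?orbT.
case: p q r s H1 H2 H3 H4 H5 H6 H7 => [[x y] b] [[x' y'] b'] [[z t] e] [[z' t'] e'].
rewrite !xpair_eqE /exchangeable /is_step /noncrossing /same_layer /apart.
rewrite /sweep /between /px /py /=.
case: b; case: b'; case: e; case: e'; rewrite /= ?andbF ?andbT.
all: case/andP=> /eqP-> H1 /andP[/eqP-> H2].
all: try move/eqP: H1 => H1; try move/eqP: H2 => H2; subst.
all: by case: (ltgtP t y) => ?; subst => /=; repeat decide_atom.
Qed.

(** The two summands are the half turns from the tangent at [p] to the direction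
    of [q], and from there to the tangent at [q]. *)
Definition rotation (p q : arrow) : int := sweep p q p + sweep p q q.

(** This is the argument of Hopf: in the triangle of the pairs of points on the
    curve, the path along the diagonal can be deformed into the path along the
    two other sides. *)
Lemma rotation_sum (n : nat) (p : nat -> arrow) :
  (forall i j, (i < j < n)%N ->
     exchangeable (p i) (p i.+1) (p j) (p j.+1)) ->
  \sum_(i < n) rotation (p i) (p i.+1)
  = \sum_(i < n) sweep (p i) (p i.+1) (p 0%N)
    + \sum_(i < n) sweep (p i) (p i.+1) (p n).
Proof.
elim: n => [|n IH] H; first by rewrite !big_ord0.
rewrite !big_ord_recr /= IH; last first.
  by move=> i j /andP[ij jn]; apply: H; rewrite ij ltnS ltnW.
have -> : \sum_(i < n) sweep (p i) (p i.+1) (p n.+1)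
  = \sum_(i < n) sweep (p i) (p i.+1) (p n)
    + \sum_(i < n) (sweep (p n) (p n.+1) (p i.+1) - sweep (p n) (p n.+1) (p i)).
  rewrite -big_split /=; apply: eq_bigr => i _.
  have := H i n; rewrite ltn_ord ltnSn /exchangeable => /(_ isT) E.
  by rewrite addrA E addrAC subrr add0r.
have -> : \sum_(i < n) (sweep (p n) (p n.+1) (p i.+1) - sweep (p n) (p n.+1) (p i))
  = sweep (p n) (p n.+1) (p n) - sweep (p n) (p n.+1) (p 0%N).
  rewrite -(big_mkord xpredT (fun i =>
    sweep (p n) (p n.+1) (p i.+1) - sweep (p n) (p n.+1) (p i))).
  by rewrite telescope_sumr.
rewrite /rotation; ring.
Qed.

Lemma sweep_potential (n : nat) (p : nat -> arrow) (w : arrow) (f : nat -> int) :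
  (forall i, (i < n)%N -> sweep (p i) (p i.+1) w = f i.+1 - f i) ->
  \sum_(i < n) sweep (p i) (p i.+1) w = f n - f 0%N.
Proof.
move=> H; rewrite (eq_bigr (fun i : 'I_n => f i.+1 - f i)) => [|i _]; last exact: H.
by rewrite -(big_mkord xpredT (fun i => f i.+1 - f i)) telescope_sumr.
Qed.

Definition lower (w q : arrow) : bool :=
  (py q < py w) || ((py q == py w) && (px q < px w)).

(** Seen from a rightmost point, the curve passes between the two half planes on
    the left only. *)
Lemma sweep_lower (w p q : arrow) : is_step p q -> apart p w -> apart q w ->
  px p <= px w -> px q <= px w ->
  sweep p q w = (lower w q)%:Z - (lower w p)%:Z.
Proof.
case: p q w => [[x y] b] [[x' y'] b'] [[z t] e].
rewrite /is_step /apart /sweep /lower /px /py /=.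
case: b; case: b' => /=; case/andP=> /eqP-> H; try move/eqP: H => H; subst.
all: by case: (ltgtP t y) => ?; subst => /=; repeat decide_atom.
Qed.

Lemma sweep_lower_start (w q : arrow) : is_step w q -> w.2 -> apart q w ->
  px q <= px w -> sweep w q w = (lower w q)%:Z.
Proof.
case: q w => [[x' y'] b'] [[z t] e].
rewrite /is_step /apart /sweep /lower /px /py /=.
by case: e => //; case: b' => /=; case/andP=> /eqP->; repeat decide_atom.
Qed.

Lemma sweep_lower_end (w p : arrow) : is_step p w -> w.2 -> apart p w ->
  px p <= px w -> sweep p w w = 1 - (lower w p)%:Z.
Proof.
case: p w => [[x y] b] [[z t] e].
rewrite /is_step /apart /sweep /lower /px /py /=.
by case: e => //; case: b => /=; case/andP=> /eqP->; repeat decide_atom.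
Qed.

(** The starting point is passed upwards and is rightmost, so that the curve
    surrounds its interior anticlockwise. *)
Theorem closed_rotation (n : nat) (p : nat -> arrow) :
  (0 < n)%N -> p n = p 0%N -> (p 0%N).2 ->
  (forall i, (i < n)%N -> is_step (p i) (p i.+1)) ->
  (forall i, (0 < i < n)%N -> apart (p i) (p 0%N)) ->
  (forall i, (i < n)%N -> px (p i) <= px (p 0%N)) ->
  (forall i j, (i < j < n)%N ->
     exchangeable (p i) (p i.+1) (p j) (p j.+1)) ->
  \sum_(i < n) rotation (p i) (p i.+1) = 2.
Proof.
move=> n0 pn b0 st ap le ex.
rewrite rotation_sum // pn.
have n1 : (1 < n)%N.
  rewrite ltn_neqAle n0 andbT; apply/eqP => n1; have := st 0%N n0.
  rewrite -{}n1 in pn *; rewrite pn /is_step.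
  by case: (p 0%N).2; rewrite ?eqxx ?andbF //; lia.
pose w := p 0%N.
(* The direction from [w] to the curve starts out upwards along the tangent;
   returning from below, it ends up one half turn later. *)
rewrite (@sweep_potential _ _ _ (fun k =>
    if k == 0%N then 0 else if k == n then 1 else (lower w (p k))%:Z)).
  by rewrite /= eqxx -[n == 0%N]negbK -lt0n n0.
move=> [|i] Hi /=.
  rewrite ltn_eqF // -/w sweep_lower_start ?subr0 //; [exact: (st 0%N)|exact: ap|exact: le].
rewrite (ltn_eqF Hi) /=; case: eqP => [E|/eqP E].
  have := st _ Hi; rewrite E pn => st'.
  by rewrite sweep_lower_end ?le //; apply: ap.
have Hi2 : (i.+2 < n)%N by rewrite ltn_neqAle E.
by apply: sweep_lower; rewrite ?le //; [apply: st | apply: ap | apply: ap].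
Qed.

(** For a point [w] on the lowest level ([bot] true), the curve is in the lower
    half plane only on the level of [w], to the left; for a point on the highest
    level, it is in the upper half plane only on that level, to the right. *)
Definition beside (bot : bool) (w q : arrow) : bool :=
  (py q == py w) && (if bot then px q < px w else px w < px q).

Lemma beside_refl bot w : beside bot w w = false.
Proof. by rewrite /beside !ltxx if_same andbF. Qed.

(** No arc separates [w] from infinity, below if [bot] is true and above
    otherwise. *)
Definition exposed (bot : bool) (w p q : arrow) : bool :=
  (if bot then (py w <= py p) && (py w <= py q)
   else (py p <= py w) && (py q <= py w)) &&
  ((p.2 == ~~ bot) && (q.2 == bot) && (py p == py w)
   ==> ~~ between (px p) (px q) (px w)).

Lemma sweep_beside (bot : bool) (w p q : arrow) :
  is_step p q -> apart p w -> apart q w -> exposed bot w p q ->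
  sweep p q w = (beside bot w q)%:Z - (beside bot w p)%:Z.
Proof.
case: p q w => [[x y] b] [[x' y'] b'] [[z t] e].
rewrite /is_step /apart /sweep /beside /exposed /between /px /py /=.
case: bot; case: b; case: b' => /=; case/andP=> /eqP-> H; try move/eqP: H => H; subst.
all: by case: (ltgtP t y) => ?; subst => //=; repeat decide_atom.
Qed.

Lemma sweep_beside_start (bot : bool) (w q : arrow) :
  is_step w q -> w.2 = bot -> apart q w -> exposed bot w w q ->
  sweep w q w = (beside bot w q)%:Z.
Proof.
case: q w => [[x' y'] b'] [[z t] e].
rewrite /is_step /apart /sweep /beside /exposed /between /px /py /=.
by case: e => + <-; case: b' => /=; case/andP=> /eqP->; repeat decide_atom.
Qed.

Lemma sweep_beside_end (bot : bool) (w p : arrow) :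
  is_step p w -> w.2 = ~~ bot -> apart p w -> exposed bot w p w ->
  sweep p w w = - (beside bot w p)%:Z.
Proof.
case: p w => [[x y] b] [[z t] e].
rewrite /is_step /apart /sweep /beside /exposed /between /px /py /=.
by case: bot; case: e => + // _; case: b => /=; case/andP=> /eqP->; repeat decide_atom.
Qed.

(** A curve that starts upwards starts at the bottom, and one that ends upwards
    ends at the top. *)
Theorem open_rotation (n : nat) (p : nat -> arrow) :
  let bot := (p 0%N).2 in let bot' := ~~ (p n).2 in
  (forall i, (i < n)%N -> is_step (p i) (p i.+1)) ->
  (forall i, (0 < i <= n)%N -> apart (p i) (p 0%N)) ->
  (forall i, (i < n)%N -> apart (p i) (p n)) ->
  (forall i, (i < n)%N -> exposed bot (p 0%N) (p i) (p i.+1)) ->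
  (forall i, (i < n)%N -> exposed bot' (p n) (p i) (p i.+1)) ->
  (forall i j, (i < j < n)%N ->
     exchangeable (p i) (p i.+1) (p j) (p j.+1)) ->
  \sum_(i < n) rotation (p i) (p i.+1)
  = (beside bot (p 0%N) (p n))%:Z - (beside bot' (p n) (p 0%N))%:Z.
Proof.
move=> bot bot' st ap0 apn e0 en ex.
rewrite rotation_sum //.
rewrite (@sweep_potential _ _ (p 0%N) (fun k => (beside bot (p 0%N) (p k))%:Z)); last first.
  move=> [|i] Hi; first rewrite beside_refl subr0.
    by apply: sweep_beside_start; [exact: st| |exact: ap0|exact: e0].
  by apply: sweep_beside; [exact: st|apply: ap0; rewrite /= (ltnW Hi)|exact: ap0|exact: e0].
rewrite (@sweep_potential _ _ (p n) (fun k => (beside bot' (p n) (p k))%:Z)); last first.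
  move=> i Hi; have [E|E] := eqVneq i.+1 n.
    have := st _ Hi; have := en _ Hi; rewrite E => en' st'.
    by rewrite beside_refl sub0r; apply: sweep_beside_end; rewrite ?negbK //; apply: apn.
  have Hi2 : (i.+1 < n)%N by rewrite ltn_neqAle E.
  by apply: sweep_beside; [exact: st|exact: apn|exact: apn|exact: en].
by rewrite !beside_refl subr0 sub0r.
Qed.

(** * Arcs of a cup diagram *)

Lemma coord_inj (Th : block_diagram) : injective (@coord Th).
Proof. by move=> i j /val_inj/val_inj. Qed.

Lemma coord_gt0 (Th : block_diagram) (i : point Th) : (0 < coord i)%N.
Proof. exact: (valP (val i)). Qed.

(** The other end of the cup at [i], or [i] itself if there is a ray at [i]. *)
Definition mate (I : finType) (c : {set diagram_arc I}) (i : I) : I :=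
  odflt i [pick k | has_cup c false i k || has_cup c true i k].

Definition right_ends (I : finType) (c : {set diagram_arc I}) (i : I) : nat :=
  #|[set a in c | if a is Cup _ j _ then j == i else false]|.

Definition signed (s : bool) (n : nat) : int := if s then n%:Z else - n%:Z.

Section CupDiagram.
Variables (Th : block_diagram) (c : {set diagram_arc (point Th)}).
Hypothesis Hc : is_cup_diagram c.

Lemma arc_at i : exists2 a, a \in c & on_arc i a.
Proof.
have /eqP/cards1P[a Ha] := one_arc_per_point Hc i.
by have := set11 a; rewrite -Ha inE => /andP[? ?]; exists a.
Qed.

Lemma arc_unique i a a' :
  a \in c -> a' \in c -> on_arc i a -> on_arc i a' -> a = a'.
Proof.
move=> ac a'c ia ia'; have /eqP/cards1P[x Hx] := one_arc_per_point Hc i.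
have: a \in [set a in c | on_arc i a] by rewrite inE ac.
have: a' \in [set a in c | on_arc i a] by rewrite inE a'c.
by rewrite Hx !inE => /eqP-> /eqP->.
Qed.

Variant mate_spec (i : point Th) : point Th -> Prop :=
  | MateRight k d of Cup i k d \in c & (coord i < coord k)%N : mate_spec i k
  | MateLeft k d of Cup k i d \in c & (coord k < coord i)%N : mate_spec i k
  | MateRay d of Ray i d \in c : mate_spec i i.

Lemma mateP i : mate_spec i (mate c i).
Proof.
rewrite /mate; case: pickP => [k|H] /=.
  rewrite /has_cup -!orbA => /or4P[] H.
  - exact: MateRight H (cup_left_right Hc H).
  - exact: MateLeft H (cup_left_right Hc H).
  - exact: MateRight H (cup_left_right Hc H).
  - exact: MateLeft H (cup_left_right Hc H).
have [[j k d|j d] ac] := arc_at i; last by move=> /= /eqP ->; apply: MateRay ac.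
move=> /= /orP[] /eqP E; subst; [have := H k|have := H j];
  by rewrite /has_cup; case: d ac => ->; rewrite ?orbT.
Qed.

Lemma mate_cupl i k d : Cup i k d \in c -> mate c i = k.
Proof.
move=> Hik; have := cup_left_right Hc Hik.
case: mateP => [m e|m e|e] H.
- by have /= := arc_unique Hik H (i := i); rewrite !eqxx => /(_ isT isT)[].
- have /= := arc_unique Hik H (i := i); rewrite !eqxx orbT => /(_ isT isT)[] <- <-.
  by rewrite ltnn.
- by have /= := arc_unique Hik H (i := i); rewrite !eqxx => /(_ isT isT).
Qed.

Lemma mate_cupr i k d : Cup i k d \in c -> mate c k = i.
Proof.
move=> Hik; have := cup_left_right Hc Hik.
case: mateP => [m e|m e|e] H.
- have /= := arc_unique Hik H (i := k); rewrite !eqxx orbT => /(_ isT isT)[] -> ->.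
  by rewrite ltnn.
- by have /= := arc_unique Hik H (i := k); rewrite !eqxx !orbT => /(_ isT isT)[].
- by have /= := arc_unique Hik H (i := k); rewrite !eqxx !orbT => /(_ isT isT).
Qed.

Lemma mate_ray i d : Ray i d \in c -> mate c i = i.
Proof.
move=> Hi; case: mateP => [m e|m e|//] H.
- by have /= := arc_unique Hi H (i := i); rewrite !eqxx => /(_ isT isT).
- by have /= := arc_unique Hi H (i := i); rewrite !eqxx orbT => /(_ isT isT).
Qed.

Lemma mateK : involutive (mate c).
Proof.
move=> i; case: (mateP i) => [k d|k d|d] H; last by rewrite (mate_ray H).
  by rewrite (mate_cupr H).
by rewrite (mate_cupl H).
Qed.

Lemma has_rayE i : has_ray c i = (mate c i == i).
Proof.
apply/existsP/eqP => [[d]|]; first exact: mate_ray.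
by case: mateP => [k d|k d|d H] // *; subst; [lia|lia|exists d].
Qed.

Lemma has_cupE i k :
  has_cup c false i k || has_cup c true i k = (mate c i == k) && (k != i).
Proof.
have ends_differ a b d : Cup a b d \in c -> b != a.
  by move=> /(cup_left_right Hc); apply: contraTneq => ->; rewrite ltnn.
rewrite /has_cup -!orbA; apply/or4P/andP => [[] H|[/eqP<-]].
- by rewrite (mate_cupl H) (ends_differ _ _ _ H).
- by rewrite (mate_cupr H) eq_sym (ends_differ _ _ _ H).
- by rewrite (mate_cupl H) (ends_differ _ _ _ H).
- by rewrite (mate_cupr H) eq_sym (ends_differ _ _ _ H).
case: mateP => [m [] H _ _|m [] H _ _|d _]; rewrite ?eqxx // ?H.
- by constructor 3.
- by constructor 1.
- by constructor 4.
- by constructor 2.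
Qed.

Lemma right_endsE i : right_ends c i = (coord (mate c i) < coord i)%N.
Proof.
rewrite /right_ends; case: mateP => [k d H lt|k d H lt|d H].
- rewrite ltnNge (ltnW lt) /=; apply/eqP; rewrite cards_eq0; apply/eqP/setP => a.
  rewrite !inE; apply/negP => /andP[]; case: a => // j m e Ha /eqP E; subst m.
  have := cup_left_right Hc Ha; have /= := arc_unique H Ha (i := i).
  by rewrite !eqxx orbT => /(_ isT isT)[] -> _; rewrite ltnn.
- rewrite lt; apply/eqP/cards1P; exists (Cup k i d); apply/setP => a; rewrite !inE.
  apply/andP/eqP => [[]|->]; last by rewrite eqxx.
  case: a => // j m e Ha /eqP E; subst m; apply/esym/(arc_unique H Ha (i := i)) => /=;
  by rewrite eqxx orbT.
- rewrite ltnn; apply/eqP; rewrite cards_eq0; apply/eqP/setP => a.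
  rewrite !inE; apply/negP => /andP[]; case: a => // j m e Ha /eqP E; subst m.
  by have /= := arc_unique H Ha (i := i); rewrite !eqxx orbT => /(_ isT isT).
Qed.

(** The boolean [s] chooses one of the two lifts of [i]; the arc leads from
    there to the same sheet if it is undotted and to the other one if it is
    dotted. Lifted dotted cups enclose the origin; they are nested in each other
    because dotted cups lie side by side, and no undotted cup is half inside one
    of them because cups do not cross and no dotted cup lies in another cup. *)
Lemma lifted_cups_separated i k d j m e s t :
  Cup i k d \in c -> Cup j m e \in c -> Cup i k d != Cup j m e ->
  between (signed s (coord i)) (signed (s (+) d) (coord k)) (signed t (coord j))
  = between (signed s (coord i)) (signed (s (+) d) (coord k))
      (signed (t (+) e) (coord m)).
Proof.
move=> H1 H2 ne.
have lt1 := cup_left_right Hc H1; have lt2 := cup_left_right Hc H2.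
have N1 := cups_noncrossing Hc H1 H2; have N2 := cups_noncrossing Hc H2 H1.
have D1 : d -> ~~ ((coord j < coord i) && (coord k < coord m))%N.
  by move=> dT; rewrite dT in H1; apply: dotted_cup_not_nested H1 H2.
have D2 : e -> ~~ ((coord i < coord j) && (coord m < coord k))%N.
  by move=> eT; rewrite eT in H2; apply: dotted_cup_not_nested H2 H1.
have share x y : on_arc x (Cup i k d) -> on_arc y (Cup j m e) -> coord x != coord y.
  move=> xi yj; apply: contra ne => /eqP/coord_inj E; subst y.
  by rewrite (arc_unique H1 H2 xi yj).
have := share i j; have := share i m; have := share k j; have := share k m.
rewrite /= !eqxx !orbT => /(_ isT isT) S1 /(_ isT isT) S2 /(_ isT isT) S3 /(_ isT isT) S4.
have := coord_gt0 i; have := coord_gt0 j.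
clear share H1 H2 ne; rewrite /between /signed.
case: s; case: t; case: d D1; case: e D2 => /= D2 D1;
  try have {}D1 := D1 isT; try have {}D2 := D2 isT; lia.
Qed.

(** A lifted dotted cup extends over the lifts of all points to its left; so it is
    essential that no ray lies there. *)
Lemma lifted_ray_outside_cup i k d j e s t :
  Cup i k d \in c -> Ray j e \in c ->
  ~~ between (signed s (coord i)) (signed (s (+) d) (coord k)) (signed t (coord j)).
Proof.
move=> H1 H2.
have lt1 := cup_left_right Hc H1.
have N1 := cup_ray_noncrossing Hc H1 H2.
have D1 : d -> ~~ (coord j < coord i)%N.
  by move=> dT; rewrite dT in H1; apply: dotted_cup_left_of_rays H1 H2.
have share x : on_arc x (Cup i k d) -> coord x != coord j.
  move=> xi; apply/eqP => /coord_inj E; subst x.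
  by have := arc_unique H1 H2 xi; rewrite /= eqxx => /(_ isT).
have := share i; have := share k.
rewrite /= !eqxx !orbT => /(_ isT) S1 /(_ isT) S2.
have := coord_gt0 i; have := coord_gt0 j.
clear share H1 H2; rewrite /between /signed.
case: s; case: t; case: d D1 => /= D1; try have {}D1 := D1 isT; lia.
Qed.

Lemma between_sym (a b x : int) : between a b x = between b a x.
Proof. by rewrite /between orbC. Qed.

Lemma lifted_cups_noncrossing i k d j m e s t :
  has_cup c d i k -> has_cup c e j m -> i != j -> i != m ->
  between (signed s (coord i)) (signed (s (+) d) (coord k)) (signed t (coord j))
  = between (signed s (coord i)) (signed (s (+) d) (coord k))
      (signed (t (+) e) (coord m)).
Proof.
have flip u b : u = (u (+) b) (+) b by rewrite -addbA addbb addbF.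
move=> /orP[] H1 /orP[] H2 ij im.
- by apply: lifted_cups_separated H1 H2 _; apply: contra ij => /eqP[->].
- rewrite {1}(flip t e); apply/esym/(lifted_cups_separated _ _ H1 H2).
  by apply: contra im => /eqP[->].
- rewrite {1 3}(flip s d) ![between (signed _ (coord i)) _ _]between_sym.
  by apply: lifted_cups_separated H1 H2 _; apply: contra im => /eqP[_ ->].
- rewrite {1 3}(flip s d) {1}(flip t e) ![between (signed _ (coord i)) _ _]between_sym.
  apply/esym/(lifted_cups_separated _ _ H1 H2).
  by apply: contra ij => /eqP[_ ->].
Qed.

Lemma lifted_cup_ray_noncrossing i k d j s t :
  has_cup c d i k -> has_ray c j ->
  ~~ between (signed s (coord i)) (signed (s (+) d) (coord k)) (signed t (coord j)).
Proof.
have flip u b : u = (u (+) b) (+) b by rewrite -addbA addbb addbF.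
move=> /orP[] H /existsP[e He]; first exact: lifted_ray_outside_cup H He.
by rewrite {1}(flip s d) between_sym; apply: lifted_ray_outside_cup H He.
Qed.

End CupDiagram.

(** * The cup diagram of a weight *)

Section ArcsOfLabels.
Variables (I : eqType) (rank : I -> nat) (down : pred I).
Let before : rel I := fun x y => (rank x < rank y)%N.

Let before_trans : transitive before.
Proof. by move=> y x z; apply: ltn_trans. Qed.

Let before_irr : irreflexive before.
Proof. by move=> x; apply: ltnn. Qed.

Definition ends (a : diagram_arc I) : seq I :=
  match a with Cup i j _ => [:: i; j] | Ray i _ => [:: i] end.

Definition all_ends (l : seq (diagram_arc I)) : seq I := flatten (map ends l).

Lemma all_ends_cat l1 l2 : all_ends (l1 ++ l2) = all_ends l1 ++ all_ends l2.
Proof. by rewrite /all_ends map_cat flatten_cat. Qed.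

Lemma mem_all_ends l a i : a \in l -> i \in ends a -> i \in all_ends l.
Proof. by move=> al ia; apply/flatten_mapP; exists a. Qed.

Lemma all_ends_unique l a a' i : uniq (all_ends l) ->
  a \in l -> a' \in l -> i \in ends a -> i \in ends a' -> a = a'.
Proof.
elim: l => //= b l IH; rewrite /all_ends /= cat_uniq => /and3P[_ /hasPn dis u].
rewrite !inE => /predU1P[->|al] /predU1P[->|al'] // ia ia'.
- by have := dis i (mem_all_ends al' ia'); rewrite /= ia.
- by have := dis i (mem_all_ends al ia); rewrite /= ia'.
- exact: IH.
Qed.

Lemma first_vee_wedge_some s x y : sorted before s ->
  first_vee_wedge down s = Some (x, y) ->
  [/\ x \in s, y \in s, before x y
    & forall z, z \in s -> ~~ (before x z && before z y)].
Proof.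
elim: s => //= a [|b s] IH //= /andP[ab sb].
have minb := order_path_min before_trans sb.
case: ifP => _ => [[<- <-]|/(IH sb)[xs ys xy gap]].
  split; rewrite ?inE ?eqxx ?orbT // => z; rewrite !inE.
  case/or3P => [/eqP->|/eqP->|/(allP minb) bz].
  - by rewrite before_irr.
  - by rewrite before_irr andbF.
  - by apply/negP => /andP[_ zb]; have := before_trans bz zb; rewrite before_irr.
split; [by rewrite inE xs orbT|by rewrite inE ys orbT|exact: xy|].
move=> z; rewrite inE => /predU1P[->|/gap //]; apply/negP => /andP[xa _].
have : before b x || (x == b).
  by move: xs; rewrite inE => /predU1P[->|/(allP minb) ->]; rewrite ?eqxx ?orbT.
case/orP => [bx|/eqP E]; last by have := before_trans xa ab; rewrite E before_irr.
by have := before_trans (before_trans xa ab) bx; rewrite before_irr.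
Qed.

(** Without neighbours vee, wedge, all wedges come before all vees. *)
Lemma first_vee_wedge_none s x y : sorted before s ->
  first_vee_wedge down s = None ->
  x \in s -> y \in s -> down x -> ~~ down y -> before y x.
Proof.
elim: s x y => //= a [|b s] IH x y /=.
  by move=> _ _; rewrite !inE => /eqP -> /eqP -> ->.
move=> /andP[ab sb]; have min := order_path_min before_trans sb.
have mina z : z \in b :: s -> before a z.
  by rewrite inE => /predU1P[->//|/(allP min)]; apply: before_trans.
case: ifP => // Hab E; have {}IH u v := IH u v sb E.
rewrite [x \in _]inE [y \in _]inE => /predU1P[->|xs] /predU1P[->|ys] dx dy.
- by rewrite dx in dy.
- have db : down b by apply/negPn/negP => db; rewrite dx db in Hab.
  have yb : before y b by apply: IH; rewrite // inE eqxx.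
  move: ys; rewrite inE => /predU1P[Eb|/(allP min) by_]; first by rewrite Eb db in dy.
  by have := before_trans yb by_; rewrite before_irr.
- exact: mina.
- exact: IH.
Qed.

(** What the successive connection of neighbours in [s] by the cups [cs]
    achieves: as neighbours have nothing unconnected between them, no end of a
    later cup and no remaining point lies inside an earlier cup. *)
Record matching (s : seq I) (cs : seq (diagram_arc I)) (r : seq I) : Prop :=
  Matching {
  matching_ends : perm_eq (all_ends cs ++ r) s;
  matching_cups : forall a, a \in cs -> exists x y,
    [/\ a = Cup x y false, x \in s, y \in s & before x y];
  matching_noncrossing : forall i j k m, Cup i j false \in cs ->
    Cup k m false \in cs -> ~~ [&& before i k, before k j & before j m];
  matching_exposed : forall i j z, Cup i j false \in cs -> z \in r ->
    ~~ (before i z && before z j);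
  matching_sorted : sorted before r;
  matching_sub : {subset r <= s} }.

Lemma vee_wedge_cups_matching n s cs r : sorted before s ->
  vee_wedge_cups down n s = (cs, r) -> matching s cs r.
Proof.
elim: n s cs r => [|n IH] s cs r ss /=; first by move=> [<- <-]; split.
case E : first_vee_wedge => [[x y]|]; last by move=> [<- <-]; split.
case Er : vee_wedge_cups => [cs' r'] [<- <-] {cs r}.
have [xs ys xy gap] := first_vee_wedge_some ss E.
have us : uniq s by apply: sorted_uniq before_trans before_irr _ ss.
set s' := rem x (rem y s) in Er.
have s's : subseq s' s by apply: subseq_trans (rem_subseq _ _) (rem_subseq _ _).
have ss' : sorted before s' by apply: subseq_sorted before_trans _ _ s's ss.
have perm : perm_eq s (y :: x :: s').
  have xy' : x != y by apply: contraTneq xy => ->; rewrite before_irr.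
  have xr : x \in rem y s by rewrite mem_rem_uniq // inE xy' xs.
  by rewrite (perm_trans (perm_to_rem ys)) // perm_cons perm_to_rem.
have [me mc mn mx ms msub] := IH _ _ _ ss' Er.
have sub z : z \in s' -> z \in s by apply: (mem_subseq s's).
split.
- rewrite perm_sym (perm_trans perm) // perm_sym /all_ends /= -/(all_ends cs').
  by rewrite (perm_catCA [:: x] [:: y]) /= !perm_cons.
- move=> a; rewrite inE => /predU1P[->|/mc[x' [y' [-> /sub ? /sub ? ?]]]].
    by exists x, y.
  by exists x', y'.
- move=> i j k m; rewrite !inE => /predU1P[[-> ->]|ij] /predU1P[[-> ->]|km].
  + by rewrite before_irr.
  + have [k' [m' [[<- _] ks _ _]]] := mc _ km.
    by apply: contra (gap k (sub _ ks)) => /and3P[-> ->].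
  + have [i' [j' [[_ <-] _ js _]]] := mc _ ij.
    by apply: contra (gap j (sub _ js)) => /and3P[_ -> ->].
  + exact: mn.
- move=> i j z; rewrite inE => /predU1P[[-> ->]|ij] zr; last exact: mx.
  by apply/gap/sub/msub.
- exact: ms.
- by move=> z /msub/sub.
Qed.

Lemma vee_wedge_cups_rest n s cs r x y : sorted before s -> (size s <= n)%N ->
  vee_wedge_cups down n s = (cs, r) ->
  x \in r -> y \in r -> down x -> ~~ down y -> before y x.
Proof.
elim: n s cs r => [|n IH] s cs r ss /=.
  by rewrite leqn0 size_eq0 => /eqP -> [_ <-].
case E : first_vee_wedge => [[a b]|] sn; last first.
  by move=> [_ <-]; apply: first_vee_wedge_none.
case Er : vee_wedge_cups => [cs' r'] [_ <-].
have [_ bs _ _] := first_vee_wedge_some ss E.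
apply: IH Er.
  apply: subseq_sorted before_trans _ _ _ ss.
  exact: subseq_trans (rem_subseq _ _) (rem_subseq _ _).
apply: (leq_trans (size_subseq (rem_subseq _ _))); rewrite size_rem //.
by case: (size s) sn.
Qed.

Lemma dotted_arcsP t : sorted before t ->
  [/\ all_ends (dotted_arcs t) = t,
      forall i j d, Cup i j d \in dotted_arcs t ->
        [/\ d, i \in t, j \in t, before i j
          & forall z, z \in t -> ~~ (before i z && before z j)]
    & forall k d, Ray k d \in dotted_arcs t ->
        [/\ d, k \in t & forall z, z \in t -> ~~ before k z]].
Proof.
have [n] := ubnP (size t); elim: n t => // n IH [|x [|y t]] //= sn.
  move=> _; split=> // k d /orP[/eqP[-> ->]|//].
  by split; rewrite ?inE // => z; rewrite inE => /eqP ->; rewrite before_irr.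
move=> /andP[xy st]; have min := order_path_min before_trans st.
have [|IHe IHc IHr] := IH t _ (path_sorted st).
  by rewrite ltnS in sn; apply: ltnW.
have far u v : u \in [:: x; y] -> v \in t -> before u v.
  by move=> + /(allP min) yv; rewrite !inE => /orP[] /eqP ->; rewrite // (before_trans xy).
have sub z : z \in t -> z \in [:: x, y & t] by rewrite !inE => ->; rewrite !orbT.
split.
- by rewrite /all_ends /= -/(all_ends _) IHe.
- move=> i j d; rewrite inE => /predU1P[[-> -> ->]|/IHc[dT it jt ij gap]].
    split; rewrite ?inE ?eqxx ?orbT // => z; rewrite !inE.
    case/or3P => [/eqP->|/eqP->|zt]; rewrite ?before_irr ?andbF //.
    apply/negP => /andP[_ zy]; have yz := far y z _ zt.
    by have := before_trans zy (yz _); rewrite before_irr !inE eqxx orbT => /(_ isT).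
  split; [exact: dT|exact: sub|exact: sub|exact: ij|move=> z].
  rewrite -[[:: x, y & t]]/([:: x; y] ++ t) mem_cat.
  case/orP => [zxy|/gap //]; apply/negP => /andP[iz _].
  by have := before_trans iz (far _ _ zxy it); rewrite before_irr.
- move=> k d; rewrite inE => /predU1P[//|/IHr[dT kt last]].
  split; [exact: dT|exact: sub|move=> z].
  rewrite -[[:: x, y & t]]/([:: x; y] ++ t) mem_cat.
  case/orP => [zxy|/last //]; apply/negP => kz.
  by have := before_trans kz (far _ _ zxy kt); rewrite before_irr.
Qed.

End ArcsOfLabels.

Section Underline.
Variables (L : block) (lam : block_weight L).

Let down (i : point L) : bool := wt_label lam i == Down.
Let s := sort (fun i j : point L => (coord i <= coord j)%N) (enum (point L)).

Let s_sorted : sorted (fun i j : point L => (coord i < coord j)%N) s.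
Proof.
suff : sorted ltn [seq coord i | i <- s] by rewrite sorted_map.
rewrite ltn_sorted_uniq_leq; apply/andP; split.
  by rewrite map_inj_uniq ?sort_uniq ?enum_uniq //; apply: coord_inj.
by rewrite sorted_map sort_sorted // => i j; apply: leq_total.
Qed.

(** A dotted arc is attached to the wedges that remain, which precede the
    remaining vees, where the undotted rays are. No remaining point is inside an
    undotted cup, and the dotted cups join consecutive remaining wedges; so dotted
    cups are not inside other cups, and dotted arcs are not to the right of a
    ray. *)
Theorem underline_cup_diagram : is_cup_diagram (underline lam).
Proof.
rewrite /underline /arcs_of_labels -/down -/s.
case E : vee_wedge_cups => [cs r].
have M := vee_wedge_cups_matching s_sorted E.
have rest := vee_wedge_cups_rest s_sorted (leqnn _) E.
set ups := [seq x <- r | ~~ down x].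
have sub_ups : subseq ups r by apply: filter_subseq.
have trans : transitive (fun i j : point L => (coord i < coord j)%N).
  by move=> y x z; apply: ltn_trans.
have ups_r z : z \in ups -> z \in r by apply: (mem_subseq sub_ups).
have [De Dc Dr] := dotted_arcsP (subseq_sorted trans sub_ups (matching_sorted M)).
set rays := [seq Ray x false | x <- r & down x].
set l := cs ++ _.
have cupP i j d : Cup i j d \in l ->
    (d = false /\ Cup i j false \in cs)
    \/ (d = true /\ Cup i j true \in dotted_arcs ups).
  rewrite !mem_cat => /or3P[H|/mapP[? _ //]|H].
    left; have [x [y [[_ _ Ed] _ _ _]]] := matching_cups M H.
    by rewrite Ed in H *.
  by right; have [dT _ _ _ _] := Dc _ _ _ H; case: d dT H.
have rayP k d : Ray k d \in l ->
    (d = false /\ k \in r /\ down k) \/ (d = true /\ Ray k true \in dotted_arcs ups).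
  rewrite !mem_cat => /or3P[H|/mapP[x]|H].
  - by have [x [y [//]]] := matching_cups M H.
  - by rewrite mem_filter => /andP[dx xr] [-> ->]; left.
  - by right; have [dT _ _] := Dr _ _ H; case: d dT H.
have up_before_down u k : u \in ups -> k \in r -> down k -> (coord u < coord k)%N.
  by rewrite mem_filter => /andP[du ur] kr dk; apply: rest.
have mem_l a : a \in [set a in l] = (a \in l) by rewrite inE.
have l_ends : perm_eq (all_ends l) s.
  have rays_ends t : all_ends [seq Ray x false | x <- t] = t :> seq (point L).
    by elim: t => //= x t IH; rewrite /all_ends /= -/(all_ends _) IH.
  rewrite /l !all_ends_cat De rays_ends.
  apply: perm_trans (matching_ends M); rewrite perm_cat2l.
  exact/permPl/perm_filterC.
split.
- move=> i j d; rewrite mem_l => /cupP[][_ H].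
    by have [x [y [[-> ->] _ _]]] := matching_cups M H.
  by have [_ _ _] := Dc _ _ _ H.
- move=> i; have is_ : i \in all_ends l.
    by rewrite (perm_mem l_ends) mem_sort mem_enum.
  have [a al ia] := flatten_mapP is_.
  have on_ends b : on_arc i b = (i \in ends b).
    by case: b => [j k d|j d] /=; rewrite !inE.
  apply/eqP/cards1P; exists a; apply/setP => b; rewrite !inE on_ends.
  apply/andP/eqP => [[bl ib]|->]; last by [].
  apply: all_ends_unique bl al ib ia.
  by rewrite (perm_uniq l_ends) sort_uniq enum_uniq.
- move=> i j d k m e; rewrite !mem_l => /cupP[][_ H1] /cupP[][_ H2].
  + exact: (matching_noncrossing M).
  + have [_ /ups_r kr _ _ _] := Dc _ _ _ H2.
    by apply: contra (matching_exposed M H1 kr) => /and3P[-> ->].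
  + have [_ _ /ups_r jr _ _] := Dc _ _ _ H1.
    by apply: contra (matching_exposed M H2 jr) => /and3P[_ -> ->].
  + have [_ _ _ _ gap] := Dc _ _ _ H1; have [_ ku _ _ _] := Dc _ _ _ H2.
    by apply: contra (gap k ku) => /and3P[-> ->].
- move=> i j d k e; rewrite !mem_l => /cupP[][_ H1] /rayP[][_ H2].
  + by apply: (matching_exposed M H1); case: H2.
  + by apply: (matching_exposed M H1); have [_ /ups_r] := Dr _ _ H2.
  + have [_ _ ju _ _] := Dc _ _ _ H1; have [kr dk] := H2.
    by have := up_before_down _ _ ju kr dk; lia.
  + by have [_ _ _ _ gap] := Dc _ _ _ H1; apply: gap; have [_] := Dr _ _ H2.
- move=> i j k m e; rewrite !mem_l => /cupP[][] // _ H1 /cupP[][_ H2].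
  + have [_ /ups_r ir _ ij _] := Dc _ _ _ H1.
    by have := matching_exposed M H2 ir; move: ij => /=; lia.
  + have [_ iu _ ij _] := Dc _ _ _ H1; have [_ _ _ _ gap] := Dc _ _ _ H2.
    by have := gap i iu; move: ij => /=; lia.
- move=> i j k e; rewrite !mem_l => /cupP[][] // _ H1 /rayP[][_ H2].
  + have [_ iu _ _ _] := Dc _ _ _ H1; have [kr dk] := H2.
    by have := up_before_down _ _ iu kr dk; lia.
  + have [_ iu _ _ _] := Dc _ _ _ H1; have [_ _ last] := Dr _ _ H2.
    exact: last.
- move=> i k e; rewrite !mem_l => /rayP[][] // _ H1 /rayP[][_ H2].
  + have [_ iu _] := Dr _ _ H1; have [kr dk] := H2.
    by have := up_before_down _ _ iu kr dk; lia.
  + have [_ iu _] := Dr _ _ H1; have [_ _ last] := Dr _ _ H2.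
    exact: last.
Qed.

End Underline.

Lemma layer_cup_diagram (L : block) (h : nat) (D : stacked L h) (l : nat) :
  is_cup_diagram (layer D l).
Proof.
case: l => [|l] /=; first exact: underline_cup_diagram.
by case: insub => [m|]; [apply: cup_diagramP | apply: underline_cup_diagram].
Qed.

(** * Walking along a component *)

Local Arguments layer : simpl never.

Section Walk.
Variables (L : block) (h : nat) (D : stacked L h).
Let HD := layer_cup_diagram D.

(** A vertex with a direction of travel, upwards if the boolean is true. *)
Definition state := (vertex L h * bool)%type.

(** The layer containing the arc through which a state is left. *)
Definition ahead (x : state) : nat := (x.1.2 + x.2)%N.

Definition reverse (x : state) : state := (x.1, ~~ x.2).

Definition at_end (x : state) : bool :=
  if x.2 then at_top_ray D x.1 else at_bottom_ray D x.1.

(** At the end of a line the walk turns round, which makes [advance] a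
    permutation of the states. *)
Definition advance (x : state) : state :=
  let: ((i, l), b) := x in
  let k := mate (layer D (ahead x)) i in
  if k != i then ((k, l), ~~ b)
  else if b then if (l < h)%N then ((i, inord l.+1), b) else reverse x
  else if (0 < l)%N then ((i, inord l.-1), b) else reverse x.

Arguments advance : simpl never.

Variant advance_spec (x : state) : state -> Prop :=
  | AdvanceCup k of k = mate (layer D (ahead x)) x.1.1 & k != x.1.1 & ~~ at_end x :
      advance_spec x ((k, x.1.2), ~~ x.2)
  | AdvanceRay (m : 'I_h.+1) of x.1.1 = mate (layer D (ahead x)) x.1.1
      & (if x.2 then m = x.1.2.+1 :> nat else x.1.2 = m.+1 :> nat)
      & ~~ at_end x :
      advance_spec x ((x.1.1, m), x.2)
  | AdvanceEnd of x.1.1 = mate (layer D (ahead x)) x.1.1 & at_end x :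
      advance_spec x (reverse x).

Lemma advanceP x : advance_spec x (advance x).
Proof.
case: x => [[i l] b]; rewrite /advance.
case: ifPn => [ki|].
  apply: (AdvanceCup (x := ((i, l), b))) => //; rewrite /at_end /=; apply: contra ki.
  by case: b => /andP[/= /eqP El];
    rewrite (has_rayE (HD _)) /ahead /= ?El ?addn1 ?addn0 ?El.
rewrite negbK => /eqP ki; have lh := ltn_ord l.
case: b ki => ki.
  case: ltnP => lt.
    apply: (AdvanceRay (x := ((i, l), true))) => //=; first by rewrite inordK.
    by rewrite /at_end /at_top_ray /= ltn_eqF.
  have E : l = h :> nat by lia.
  apply: AdvanceEnd => //; rewrite /at_end /at_top_ray /= E eqxx /= (has_rayE (HD _)).
  by move: ki; rewrite /ahead /= E addn1 => ->.
case: ltnP => lt.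
  apply: (AdvanceRay (x := ((i, l), false))) => //=; first by rewrite inordK; lia.
  by rewrite /at_end /at_bottom_ray /= gtn_eqF.
have E : l = 0%N :> nat by lia.
apply: AdvanceEnd => //; rewrite /at_end /at_bottom_ray /= E eqxx /= (has_rayE (HD _)).
by move: ki; rewrite /ahead /= E addn0 => ->.
Qed.

Lemma reverseK : involutive reverse.
Proof. by case=> v b; rewrite /reverse /= negbK. Qed.

(** Walking is reversible: this is why [advance] is injective. *)
Lemma advance_reverse x : advance (reverse (advance x)) = reverse x.
Proof.
case: (advanceP x) => [k Ek kx|m Ex Em|Ex] He.
- case: (advanceP _) => [k' Ek'|m Ek'|Ek']; rewrite /reverse /= ?negbK.
  + rewrite /ahead /= negbK in Ek'; rewrite /ahead Ek (mateK (HD _)) in Ek'.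
    by subst; rewrite -surjective_pairing.
  + rewrite /ahead /= negbK in Ek'; rewrite Ek (mateK (HD _)) -Ek in Ek'.
    by rewrite Ek' eqxx in kx.
  + rewrite /ahead /= negbK in Ek'; rewrite Ek (mateK (HD _)) -Ek in Ek'.
    by rewrite Ek' eqxx in kx.
- have E : ahead (reverse (x.1.1, m, x.2)) = ahead x.
    by rewrite /ahead /=; case: x.2 Em => /= ->; rewrite ?addn0 ?addn1.
  have Ee : at_end (reverse (x.1.1, m, x.2)) = false.
    apply/negbTE; rewrite /at_end /reverse /at_top_ray /at_bottom_ray /=.
    case: x.2 Em => /= Em; first by rewrite Em.
    by have := ltn_ord x.1.2; apply: contraL => /andP[/eqP Eh _]; rewrite Em Eh ltnn.
  case: (advanceP _) => [k' Ek' ne|m' Ex' Em'|Ek']; rewrite ?Ee // => _.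
  + by rewrite E /= -Ex in Ek'; rewrite Ek' eqxx in ne.
  + rewrite /reverse /= in Em' *; congr (_, _); rewrite [RHS]surjective_pairing /=.
    congr (_, _); apply: val_inj => /=.
    by case: x.2 Em Em' => /= -> // [].
- rewrite reverseK; case: advanceP => // [k Ek ne|m _ _]; last by rewrite He.
  by rewrite He.
Qed.

Lemma advance_inj : injective advance.
Proof.
apply: (can_inj (g := fun y => reverse (advance (reverse y)))) => x.
by rewrite advance_reverse reverseK.
Qed.

Lemma advance_end x : at_end x = (advance x == reverse x).
Proof.
case: advanceP => [k _ ne|m _ _|_] He; rewrite ?He ?eqxx //.
  rewrite (negbTE He); apply/esym/eqP; rewrite /reverse => -[E].
  by rewrite -E eqxx in ne.
by rewrite (negbTE He); apply/esym/eqP; rewrite /reverse; case: x.2 => -[].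
Qed.

Definition adjacent (v w : vertex L h) : bool := step D true v w || step D false v w.

Lemma adjacentP v w : v != w ->
  adjacent v w = [exists b, (advance (v, b)).1 == w].
Proof.
move=> vw; rewrite /adjacent /step /joined_by_cup /joined_by_rays.
case: v w vw => [i l] [k m] /= vw.
rewrite orbA -andb_orr orbACA !(has_cupE (HD _)).
apply/idP/existsP => [/orP[/andP[/eqP<-]|/andP[/eqP<-]]|].
- case/orP => /andP[/eqP E ki]; [exists false|exists true];
  case: advanceP => [k' -> _ _|m' Ex _ _|Ex _]; rewrite /ahead /= ?addn0 ?addn1 ?E //;
  move: Ex; rewrite /ahead /= ?addn0 ?addn1 E => Ek; by rewrite -Ek eqxx in ki.
- case/orP => /andP[/eqP El]; rewrite (has_rayE (HD _)) => /eqP Er.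
    exists true; case: advanceP => [k' -> /= + _|m' /= _ Em _|Ex /=].
    + by rewrite /ahead /= addn1 -El Er eqxx.
    + by apply/eqP; congr (_, _); apply: val_inj => /=; rewrite Em El.
    + rewrite /at_end /= /at_top_ray /= => /andP[/eqP E _].
      by have := ltn_ord m; rewrite El E ltnn.
  exists false; case: advanceP => [k' -> /= + _|m' /= _ Em _|Ex /=].
  + by rewrite /ahead /= addn0 Er eqxx.
  + by apply/eqP; congr (_, _); apply: val_inj => /=; rewrite El in Em; case: Em.
  + by rewrite /at_end /= /at_bottom_ray /= El.
case=> b; case: advanceP => [k' /= -> ne _ |m' /= Ex Em _|_ _] /= /eqP E.
- case: E => <- <-; rewrite eqxx /= ne !andbT.
  by case: b ne => _; rewrite /ahead /= ?addn0 ?addn1 eqxx ?orbT.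
- case: E Em => <- <-; case: b Ex => /= Ex Em; rewrite eqxx !(has_rayE (HD _)) ?Em eqxx -Em.
  + by move: Ex; rewrite /ahead /= addn1 -Em => <-; rewrite eqxx orbT.
  + by move: Ex; rewrite /ahead /= addn0 => <-; rewrite eqxx !orbT.
- by rewrite E eqxx in vw.
Qed.

End Walk.

Arguments advance : simpl never.

Section Component.
Variables (L : block) (h : nat) (D : stacked L h).

Lemma adjacent_sym : symmetric (adjacent D).
Proof.
move=> v w; have [->//|vw] := eqVneq v w.
have half u u' : u != u' -> adjacent D u u' -> adjacent D u' u.
  move=> uu'; rewrite !adjacentP // 1?eq_sym // => /existsP[b /eqP <-].
  by apply/existsP; exists (~~ (advance D (u, b)).2); rewrite -/(reverse _) advance_reverse.
by apply/idP/idP; apply: half; rewrite // eq_sym.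
Qed.

Lemma same_comp_sym : connect_sym (adjacent D).
Proof. exact: sym_connect_sym adjacent_sym. Qed.

Lemma same_comp_advance x : same_comp D x.1 (advance D x).1.
Proof.
have [E|E] := eqVneq x.1 (advance D x).1; first by rewrite -E; apply: connect0.
apply: connect1; rewrite -/(adjacent D _ _) adjacentP //.
by apply/existsP; exists x.2; rewrite -surjective_pairing.
Qed.

Definition walk (x : state L h) (k : nat) : state L h := iter k (advance D) x.

Lemma same_comp_walk x k : same_comp D x.1 (walk x k).1.
Proof.
elim: k => [|k IH]; first exact: connect0.
exact: connect_trans IH (same_comp_advance _).
Qed.

(** The neighbours of a vertex are found by advancing in the two directions, and
    backwards from inside the walk this leads back into it; so the walk exhausts
    the component as soon as it does not leave itself at its two ends. *)
Lemma comp_walk n x :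
  (exists2 k, (k <= n)%N & (advance D (reverse x)).1 = (walk x k).1) ->
  (exists2 k, (k <= n)%N & (walk x n.+1).1 = (walk x k).1) ->
  same_comp D x.1 =i [seq (walk x k).1 | k <- iota 0 n.+1].
Proof.
move=> [k0 k0n H0] [k1 k1n H1]; set s := [seq (walk x k).1 | k <- iota 0 n.+1].
have inS k : (k <= n)%N -> (walk x k).1 \in s.
  by move=> kn; apply/mapP; exists k; rewrite // mem_iota.
have cl v w : adjacent D v w -> v \in s -> w \in s.
  move=> vw /mapP[k]; rewrite mem_iota => /= kn E.
  have [<-|ne] := eqVneq v w; first by rewrite E inS.
  move: vw; rewrite adjacentP // => /existsP[b /eqP <-] {ne w}.
  have [Eb|Eb] := eqVneq b (walk x k).2.
    rewrite E Eb -surjective_pairing; case: (ltngtP k n) => [lt|gt|->].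
    - exact: (inS k.+1 lt).
    - by move: kn; rewrite add0n ltnS leqNgt gt.
    - by rewrite -[advance _ _]/(walk x n.+1) H1 inS.
  have -> : (v, b) = reverse (walk x k).
    by rewrite /reverse E; case: b (walk x k).2 Eb => [] [].
  case: k kn {Eb E} => [|k] kn; first by rewrite H0 inS.
  rewrite /walk iterS advance_reverse //= -/(walk x k) inS //.
  by rewrite add0n ltnS in kn; apply: ltnW.
move=> w; apply/idP/idP => [|/mapP[k _ ->]]; last exact: same_comp_walk.
case/connectP=> q; have : x.1 \in s by exact: (inS 0%N).
move: (x.1) => u; clearbody s; clear -cl.
elim: q u => [|v q IH] u us.
  by move=> _ ->; exact: us.
case/andP=> uv vq E; exact: IH (cl _ _ uv us) vq E.
Qed.

(** If the walk meets a state again in the opposite direction, then the part in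
    between is invariant under reversal, and the walk turns round at its middle,
    which is the end of a line. *)
Lemma walk_reverse a c x : (c <= a)%N -> walk x a = reverse (walk x c) ->
  exists2 k, (c <= k < a)%N & at_end D (walk x k).
Proof.
move Em : (a - c)%N => m; elim/ltn_ind: m a c Em => m IH a c Em ca H.
have ne (y : state L h) : y <> reverse y by case: y => v [].
case: a Em ca H => [|a] Em ca H.
  by move: ca H; rewrite leqn0 => /eqP-> /ne.
have [E|ne'] := eqVneq a.+1 c; first by rewrite E in H; case: (ne _ H).
have {ne'}ca' : (c <= a)%N by rewrite -ltnS ltn_neqAle eq_sym ne'.
have [E|ne'] := eqVneq a c.
  subst; exists c; rewrite ?leqnn ?ltnSn // advance_end //.
  by rewrite -[advance _ _]/(walk x c.+1) H.
have lt : (c < a)%N by rewrite ltn_neqAle eq_sym ne'.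
have E : walk x a = reverse (walk x c.+1).
  apply: (@advance_inj _ _ D); rewrite -[LHS]/(walk x a.+1) H.
  by rewrite /walk iterS advance_reverse.
have [||k /andP[k1 k2] k3] := IH (a - c.+1)%N _ a c.+1 erefl _ E; [lia|done|].
by exists k => //; rewrite (ltnW k1) ltnS (ltnW k2).
Qed.

Lemma walk_injective n x :
  (forall k, (0 < k <= n)%N -> walk x k != x) ->
  (forall k, (k < n)%N -> ~~ at_end D (walk x k)) ->
  uniq [seq (walk x k).1 | k <- iota 0 n.+1].
Proof.
move=> Hx He; rewrite map_inj_in_uniq ?iota_uniq // => a c.
rewrite !mem_iota /= !add0n !ltnS.
wlog ca : a c / (c <= a)%N.
  by move=> H an cn E; case: (leqP c a) => ?; [|apply/esym]; apply: H => //; apply: ltnW.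
move=> an cn E; have [//|ne] := eqVneq a c.
have {ne}ca : (c < a)%N by rewrite ltn_neqAle eq_sym ne.
have [E2|E2] := eqVneq (walk x a).2 (walk x c).2.
  have : walk x a = walk x c by rewrite [LHS]surjective_pairing E E2 -surjective_pairing.
  rewrite /walk -(subnK (ltnW ca)) addnC iterD => H.
  have := Hx (a - c)%N; rewrite subn_gt0 ca (leq_trans (leq_subr _ _) an) => /(_ isT).
  have -> : walk x (a - c) = x; last by rewrite eqxx.
  by move: (a - c)%N H => m; clear; elim: c => [|c IH] //; by move/(@advance_inj _ _ D).
have [|k /andP[_ k1] k2] := @walk_reverse a c x (ltnW ca).
  rewrite [LHS]surjective_pairing E /reverse; congr (_, _).
  by case: (walk x a).2 (walk x c).2 E2 => [] [].
by have := He k (leq_trans k1 an); rewrite k2.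
Qed.

End Component.

Section Cover.
Variables (L : block) (h : nat) (D : stacked L h).

Record covers (x : state L h) (n : nat) : Prop := Covers {
  cover_uniq : uniq [seq (walk D x k).1 | k <- iota 0 n.+1];
  cover_comp : same_comp D x.1 =i [seq (walk D x k).1 | k <- iota 0 n.+1];
  cover_end : forall k, (k < n)%N -> ~~ at_end D (walk D x k) }.

Lemma big_comp (R : Type) (idx : R) (op : Monoid.com_law idx)
    (F : vertex L h -> R) x n : covers x n ->
  \big[op/idx]_(w | same_comp D x.1 w) F w
  = \big[op/idx]_(k < n.+1) F (walk D x k).1.
Proof.
move=> [u c _].
rewrite (eq_bigl (mem [seq (walk D x k).1 | k <- iota 0 n.+1])); last exact: c.
by rewrite -big_uniq // big_map -[iota _ _]/(index_iota 0 n.+1) big_mkord.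
Qed.

Lemma walk_recurrent x : exists n, walk D x n.+1 == x.
Proof.
exists (order (advance D) x).-1; rewrite prednK ?order_gt0 //.
by rewrite /walk (iter_order (@advance_inj _ _ D)).
Qed.

Lemma at_end_line x : at_end D x -> on_line D x.1.
Proof.
move=> He; apply/existsP; exists x.1; rewrite /same_comp connect0 /=.
by move: He; rewrite /at_end; case: x.2 => ->; rewrite ?orbT.
Qed.

Lemma on_line_comp v w : same_comp D v w -> on_line D w -> on_line D v.
Proof.
move=> vw /existsP[u /andP[wu Hu]]; apply/existsP; exists u.
by rewrite Hu andbT; apply: connect_trans wu.
Qed.

Lemma circle_cover x : on_circle D x.1 ->
  exists n, [/\ covers x n, walk D x n.+1 = x & ~~ at_end D (walk D x n)].
Proof.
move=> Hx; have [n /eqP wn min] := ex_minnP (walk_recurrent x).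
have noend k : ~~ at_end D (walk D x k).
  apply: contra Hx => /at_end_line; apply: on_line_comp; exact: same_comp_walk.
exists n; split=> //; split=> [||k _ //].
- apply: walk_injective => [[|k] // /andP[_ kn]|k _ //].
  by apply: contraTneq kn => /eqP /min; rewrite -leqNgt.
- apply: comp_walk; last by exists 0%N => //; rewrite wn.
  by exists n => //; rewrite -{1}wn /walk iterS advance_reverse.
Qed.

(** The walk that starts at one end of a line comes back there, reversed; so it
    turns round somewhere, which is the other end. *)
Lemma line_cover x : at_end D (reverse x) ->
  exists2 n, covers x n & at_end D (walk D x n).
Proof.
rewrite advance_end reverseK => /eqP ex.
have back k : walk D x k.+1 = x -> walk D x k = reverse (walk D x 0).
  by move=> E; apply: (@advance_inj _ _ D); rewrite /= ex.
have [m /eqP/back E] := walk_recurrent x.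
have hasend : exists k, at_end D (walk D x k).
  by have [k _ He] := walk_reverse (leq0n m) E; exists k.
have [n He min] := ex_minnP hasend; exists n => //; split.
- apply: walk_injective => [[|k] // /andP[_ kn]|k kn]; last first.
    by apply: contraTN kn => /min; rewrite -leqNgt.
  apply/eqP => /back/(walk_reverse (leq0n k))[k' k'k /min].
  by rewrite leqNgt (leq_trans _ kn) // ltnS ltnW.
- apply: comp_walk; first by exists 0%N => //; rewrite ex.
  exists n => //; move: He; rewrite advance_end => /eqP E'.
  by rewrite /walk iterS E'.
- by move=> k kn; apply: contraTN kn => /min; rewrite -leqNgt.
Qed.

(** A state in the middle of the walk is not an end in either direction; this
    gives a line exactly two ray ends. *)
Lemma end_of_line x n k b :
  at_end D (reverse x) -> covers x n -> at_end D (walk D x n) -> (k <= n)%N ->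
  (at_end D ((walk D x k).1, b) : nat)
  = ((k == 0%N) && (x.2 == ~~ b) + (k == n) && ((walk D x n).2 == b))%N.
Proof.
move=> He [_ _ noend] Hn kn.
have [E|E] := eqVneq (walk D x k).2 b.
  have -> : ((walk D x k).1, b) = walk D x k by rewrite -E -surjective_pairing.
  have -> : at_end D (walk D x k) = (k == n).
    move: kn; rewrite leq_eqVlt => /orP[/eqP->|kn]; rewrite ?eqxx ?Hn //.
    by rewrite ltn_eqF // (negbTE (noend _ kn)).
  have -> : (k == 0%N) && (x.2 == ~~ b) = false.
    by apply/negP => /andP[/eqP E0 /eqP]; rewrite -E E0 /=; case: x.2.
  by case: eqP => // <-; rewrite E eqxx.
have -> : ((walk D x k).1, b) = reverse (walk D x k).
  by rewrite /reverse; case: (walk D x k).2 b E => [] [].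
have -> : (k == n) && ((walk D x n).2 == b) = false.
  by apply/negP => /andP[/eqP <-]; rewrite (negbTE E).
rewrite addn0; case: k kn E => [|k] kn E /=.
  by rewrite He; case: x.2 b E => [] [].
have := noend _ kn; rewrite !advance_end /walk advance_reverse // reverseK.
by rewrite eq_sym => /negbTE ->.
Qed.

End Cover.

(** * The lift of an oriented component *)

Section Oriented.
Variables (L : block) (h : nat) (D : stacked L h).
Let HD := layer_cup_diagram D.
Variable nu : orientation D.

Definition is_up (v : vertex L h) : bool := label nu v == Up.

Lemma label_up (v : vertex L h) : label nu v = if is_up v then Up else Down.
Proof.
rewrite /is_up /label /wt_label; case: v => i l /=.
have /asboolP[/(_ (val i)) Hb _] := valP (val nu l).
have := valP i; rewrite !inE => /andP[_ /eqP Hi].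
by move: Hb; rewrite Hi; case: (val (val nu l) (val i)).
Qed.

Definition spin (v : vertex L h) : int := if is_up v then -1 else 1.

Definition right_end_ahead (x : state L h) : nat :=
  right_ends (layer D (ahead x)) x.1.1.

Definition right_end_count (v : vertex L h) : nat :=
  (right_end_ahead (v, false) + right_end_ahead (v, true))%N.

Lemma cup_labels x k d : has_cup (layer D (ahead x)) d x.1.1 k ->
  is_up (k, x.1.2) = is_up x.1 (+) ~~ d.
Proof.
case: x => [[i l] b] /=.
have /asboolP[cups caps _ _ _] := valP nu.
suff half i' k' : Cup i' k' d \in layer D (ahead ((i', l), b)) ->
    is_up (k', l) = is_up (i', l) (+) ~~ d.
  move=> /orP[/half //|/(half _ _)]; by move=> ->; rewrite -addbA addbb addbF.
move=> H; have : cup_degree d (label nu (i', l)) (label nu (k', l)) <> None.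
  move: H; rewrite /ahead; case: b => /=; rewrite ?addn1 ?addn0.
    exact: caps.
  exact: cups.
by rewrite !label_up; case: (is_up _); case: (is_up _); case: d {H} => //= /(_ erefl).
Qed.

Lemma ray_labels (l m : 'I_h.+1) i : m = l.+1 :> nat ->
  has_ray (layer D m) i -> is_up (i, l) = is_up (i, m).
Proof.
have /asboolP[_ _ _ _ glue] := valP nu.
by move=> ml Hi; rewrite /is_up /label /= (glue _ _ _ ml Hi).
Qed.

Section Lift.
Variable e : bool.

(** Along an undotted arc both the label and the direction of travel change,
    along a dotted one only the direction, and along a pair of glued rays neither
    does: so comparing the label with the direction tells the sheet of the double
    cover. The parameter [e] is the choice of the first sheet; on it wedges are
    passed upwards if [e] is false, and vees if [e] is true. *)
Definition sheet (x : state L h) : bool := (is_up x.1 (+) x.2) == e.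

(** The other sheet is drawn as the reflection in the origin. *)
Definition arrow_of (x : state L h) : arrow :=
  (signed (sheet x) (coord x.1.1), (x.1.2 : nat)%:Z, x.2).

Lemma arrow_dir x : (arrow_of x).2 = x.2.
Proof. by []. Qed.

Lemma px_arrow x : px (arrow_of x) = signed (sheet x) (coord x.1.1).
Proof. by []. Qed.

Lemma py_arrow x : py (arrow_of x) = (x.1.2 : nat)%:Z.
Proof. by []. Qed.

Variant lifted_advance_spec (x : state L h) : state L h -> Prop :=
  | LiftedCup k d of has_cup (layer D (ahead x)) d x.1.1 k
      & k = mate (layer D (ahead x)) x.1.1 & k != x.1.1
      & sheet ((k, x.1.2), ~~ x.2) = sheet x (+) d
      & is_up (k, x.1.2) = is_up x.1 (+) ~~ d :
      lifted_advance_spec x ((k, x.1.2), ~~ x.2)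
  | LiftedRay (m : 'I_h.+1) of has_ray (layer D (ahead x)) x.1.1
      & (if x.2 then m = x.1.2.+1 :> nat else x.1.2 = m.+1 :> nat)
      & sheet ((x.1.1, m), x.2) = sheet x
      & is_up (x.1.1, m) = is_up x.1 :
      lifted_advance_spec x ((x.1.1, m), x.2).

Lemma lifted_advanceP x : ~~ at_end D x -> lifted_advance_spec x (advance D x).
Proof.
move=> He; case: (advanceP D x) => [k Ek kx|m Ex Em|_]; rewrite ?(negbTE He) // => _.
- have : has_cup (layer D (ahead x)) false x.1.1 k
      || has_cup (layer D (ahead x)) true x.1.1 k.
    by rewrite (has_cupE (HD _)) -Ek eqxx.
  have build d : has_cup (layer D (ahead x)) d x.1.1 k ->
      lifted_advance_spec x ((k, x.1.2), ~~ x.2).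
    move=> H; apply: (LiftedCup (d := d)) => //; last exact: cup_labels.
    rewrite /sheet /= (cup_labels H).
    by case: (is_up _) x.2 d e {H} => [] [] [] [].
  by case/orP; apply: build.
have Hr : has_ray (layer D (ahead x)) x.1.1 by rewrite (has_rayE (HD _)) -Ex.
have Eup : is_up (x.1.1, m) = is_up x.1.
  rewrite [x.1 in RHS]surjective_pairing.
  move: Hr; rewrite /ahead; case: x.2 Em => /= Em; rewrite ?addn1 ?addn0 => Hr.
    by apply/esym/ray_labels; rewrite ?Em.
  by apply: ray_labels.
by apply: LiftedRay => //; rewrite /sheet /= Eup.
Qed.

Lemma arrow_of_next x (k : point L) (m : 'I_h.+1) (b d : bool) :
  sheet ((k, m), b) = sheet x (+) d ->
  arrow_of ((k, m), b) = (signed (sheet x (+) d) (coord k), (m : nat)%:Z, b).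
Proof. by move=> E; rewrite /arrow_of E. Qed.

Lemma arrow_is_step x : ~~ at_end D x -> is_step (arrow_of x) (arrow_of (advance D x)).
Proof.
case/lifted_advanceP => [k d _ _ kx Es _|m _ Em Es _].
  rewrite (arrow_of_next Es) [arrow_of x]/arrow_of.
  have ne : coord k != coord x.1.1 by apply: contra kx => /eqP/coord_inj ->.
  have := coord_gt0 k; have := coord_gt0 x.1.1; move: ne.
  move: (coord k) (coord x.1.1) (sheet x) (x.1.2 : nat) x.2 => a b s y u.
  clear; rewrite /is_step /px /py /= eqxx /signed.
  by case: u; case: s; case: d => /=; lia.
rewrite -[sheet x]addbF in Es; rewrite (arrow_of_next Es) addbF [arrow_of x]/arrow_of.
move: Em; move: (signed _ _) (x.1.2 : nat) (m : nat) x.2 => a y y' u; clear.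
by rewrite /is_step /px /py /=; case: u => ->; rewrite eqxx /=; lia.
Qed.

(** A lifted cup or cap rotates anticlockwise exactly when its right end is passed
    upwards; on either sheet this happens for the same label of the right end of
    the original arc. *)
Lemma arrow_rotation x : ~~ at_end D x ->
  (right_end_ahead x)%:Z * spin x.1
  + (right_end_ahead (reverse (advance D x)))%:Z * spin (advance D x).1
  = (if e then 1 else -1) * rotation (arrow_of x) (arrow_of (advance D x)).
Proof.
move=> He; rewrite /right_end_ahead !(right_endsE (HD _)).
case: (lifted_advanceP He) => [k d _ Ek kx Es Eu|m Hr Em Es Eu].
  have -> : ahead (reverse (k, x.1.2, ~~ x.2)) = ahead x by rewrite /ahead /= negbK.
  have Ek' : mate (layer D (ahead x)) k = x.1.1 by rewrite Ek (mateK (HD _)).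
  rewrite -[(reverse (k, x.1.2, ~~ x.2)).1.1]/k -Ek Ek'.
  rewrite (arrow_of_next Es) [arrow_of x]/arrow_of /spin.
  rewrite -[(k, _, _).1]/(k, x.1.2) Eu /sheet.
  have ne : coord k != coord x.1.1 by apply: contra kx => /eqP/coord_inj ->.
  have := coord_gt0 k; have := coord_gt0 x.1.1; move: ne.
  move: (coord k) (coord x.1.1) (is_up x.1) (x.1.2 : nat) x.2 => a b s y u; clear.
  rewrite /rotation /sweep /px /py /signed.
  by case: u; case: s; case: e; case: d => /=; rewrite !eqxx; lia.
have -> : ahead (reverse (x.1.1, m, x.2)) = ahead x.
  by rewrite /ahead /=; case: x.2 Em => /= ->; rewrite ?addn0 ?addn1.
move: Hr; rewrite (has_rayE (HD _)) => /eqP ->.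
rewrite -[(reverse (x.1.1, m, x.2)).1.1]/(x.1.1) ltnn !mul0r.
rewrite -[sheet x]addbF in Es; rewrite (arrow_of_next Es) addbF [arrow_of x]/arrow_of.
move: (signed _ _) (x.1.2 : nat) (m : nat) x.2 => a y y' u; clear.
rewrite /rotation /sweep /px /py.
by case: u => /=; rewrite !ltxx !andbF subrr mulr0.
Qed.

End Lift.
End Oriented.

(** * Values of components *)

Section Value.
Variables (L : block) (h : nat) (D : stacked L h).
Let HD := layer_cup_diagram D.
Variable nu : orientation D.

Lemma arrow_apart e x z : x.1 != z.1 -> apart (arrow_of nu e x) (arrow_of nu e z).
Proof.
rewrite /apart !py_arrow !px_arrow; apply: contraNT.
rewrite negb_imply negbK => /andP[/eqP[El] /eqP Ep].
have Ec : coord x.1.1 = coord z.1.1.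
  have := coord_gt0 x.1.1; have := coord_gt0 z.1.1.
  move: Ep; rewrite /signed; move: (coord x.1.1) (coord z.1.1) => a b.
  by case: sheet; case: sheet; lia.
by rewrite [x.1]surjective_pairing [z.1]surjective_pairing (coord_inj Ec) (val_inj El).
Qed.

Lemma arrow_noncrossing e x z : ~~ at_end D x -> ~~ at_end D z ->
  x.1 != z.1 -> advance D x = z \/ (advance D x).1 != z.1 ->
  advance D z = x \/ (advance D z).1 != x.1 ->
  noncrossing (arrow_of nu e x) (arrow_of nu e (advance D x))
    (arrow_of nu e z) (arrow_of nu e (advance D z)).
Proof.
move=> Hx Hz xz nxz nzx; rewrite /noncrossing; apply/implyP => /eqP Ea.
have {}Ea : ahead x = ahead z.
  by move: Ea; rewrite /ahead /arrow_of /py /=; case: x.2; case: z.2 => /=; lia.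
have eqb b : (b == ~~ b) = false by case: b.
case: (lifted_advanceP nu e Hx) nxz => [k d Hk _ kx Es _|m Hm Em Es _] nxz;
case: (lifted_advanceP nu e Hz) nzx => [k' d' Hk' _ kz Es' _|m' Hm' Em' Es' _] nzx;
  rewrite !arrow_dir !px_arrow ?Es ?Es'.
- rewrite -[(k, _, _).2]/(~~ x.2) -[(k', _, _).2]/(~~ z.2) !eqb; apply/implyP => /eqP Eb.
  have El : x.1.2 = z.1.2.
    by apply: val_inj; move: Ea; rewrite /ahead Eb => /addIn.
  apply/eqP; rewrite -Ea in Hk'; apply: (lifted_cups_noncrossing (HD _) _ _ Hk Hk').
    apply: contra xz => /eqP E.
    by rewrite [x.1]surjective_pairing [z.1]surjective_pairing E El.
  case: nzx => [/(congr1 snd)/=|]; first by rewrite Eb; case: z.2.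
  by apply: contra => /eqP E; rewrite [X in _ == X]surjective_pairing -E El.
- rewrite -[(k, _, _).2]/(~~ x.2) -[(_, m', _).2]/(z.2) eqb eqxx.
  by rewrite -Ea in Hm'; apply: (lifted_cup_ray_noncrossing (HD _) _ _ Hk Hm').
- rewrite -[(_, m, _).2]/(x.2) -[(k', _, _).2]/(~~ z.2) eqb eqxx.
  by rewrite Ea in Hm; apply: (lifted_cup_ray_noncrossing (HD _) _ _ Hk' Hm).
- by rewrite -[(_, m, _).2]/(x.2) -[(_, m', _).2]/(z.2) !eqxx.
Qed.

Lemma arrow_exchange e x z : ~~ at_end D x -> ~~ at_end D z ->
  x.1 != z.1 -> (advance D x).1 != (advance D z).1 ->
  advance D x = z \/ (advance D x).1 != z.1 ->
  advance D z = x \/ (advance D z).1 != x.1 ->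
  exchangeable (arrow_of nu e x) (arrow_of nu e (advance D x))
    (arrow_of nu e z) (arrow_of nu e (advance D z)).
Proof.
move=> Hx Hz xz nxnz nxz nzx; apply: sweep_exchange.
- exact: arrow_is_step.
- exact: arrow_is_step.
- exact: arrow_noncrossing.
- exact: arrow_apart.
- exact: arrow_apart.
- by case: nxz => [->|?]; [left|right; apply: arrow_apart].
- by case: nzx => [->|?]; [left|right; apply: arrow_apart].
Qed.

Definition component_value (v : vertex L h) : int :=
  \sum_(w | same_comp D v w) (right_end_count D w)%:Z * spin nu w.

(** The two last terms are the arcs at the ends of the walk that are not
    traversed by it: for a circle, both belong to the arc that closes it; for a
    line, they belong to its ray ends and vanish. *)
Lemma component_value_walk e x n : covers D x n ->
  component_value x.1
  = (if e then 1 else -1)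
    * \sum_(k < n) rotation (arrow_of nu e (walk D x k)) (arrow_of nu e (walk D x k.+1))
    + (right_end_ahead D (reverse x))%:Z * spin nu x.1
    + (right_end_ahead D (walk D x n))%:Z * spin nu (walk D x n).1.
Proof.
move=> cov; rewrite /component_value (big_comp _ _ cov).
pose f k := (right_end_ahead D (walk D x k))%:Z * spin nu (walk D x k).1.
pose g k := (right_end_ahead D (reverse (walk D x k)))%:Z * spin nu (walk D x k).1.
have fgE k : (k <= n)%N ->
    (right_end_count D (walk D x k).1)%:Z * spin nu (walk D x k).1 = f k + g k.
  move=> _; rewrite /f /g -mulrDl -PoszD; congr (_%:Z * _).
  by rewrite /right_end_count /reverse; case: (walk D x k) => v [] //=; rewrite addnC.
have stepE k : (k < n)%N -> (if e then 1 else -1)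
    * rotation (arrow_of nu e (walk D x k)) (arrow_of nu e (walk D x k.+1))
    = f k + g k.+1.
  by move=> kn; rewrite -arrow_rotation //; exact: (cover_end cov kn).
suff main : \sum_(k < n.+1) (f k + g k)
    = \sum_(k < n) (f k + g k.+1) + g 0%N + f n.
  rewrite (eq_bigr (fun k : 'I_n.+1 => f k + g k)) => [|k _]; last first.
    by apply: fgE; rewrite -ltnS.
  rewrite mulr_sumr [in RHS](eq_bigr (fun k : 'I_n => f k + g k.+1)) => [//|k _].
  exact: stepE.
clear; move: f g => f g; rewrite !big_split big_ord_recr big_ord_recl /=.
ring.
Qed.

Lemma cover_apart x n a c : covers D x n -> (a <= n)%N -> (c <= n)%N -> a != c ->
  (walk D x a).1 != (walk D x c).1.
Proof.
move=> [u _ _] an cn; apply: contra => /eqP E.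
have := nth_uniq x.1 _ _ u (i := a) (j := c); rewrite size_map size_iota !ltnS an cn.
move=> /(_ isT isT); rewrite !(nth_map 0%N) ?size_iota ?ltnS // !nth_iota ?ltnS //.
by rewrite !add0n E eqxx => <-.
Qed.

Lemma cover_exchange e x n a c : covers D x n -> (a < c < n)%N ->
  exchangeable (arrow_of nu e (walk D x a)) (arrow_of nu e (walk D x a.+1))
    (arrow_of nu e (walk D x c)) (arrow_of nu e (walk D x c.+1)).
Proof.
move=> cov /andP[ac cn]; apply: arrow_exchange.
- by apply: (cover_end cov); apply: ltn_trans cn.
- exact: (cover_end cov).
- by apply: (cover_apart cov); rewrite ?ltn_eqF //; lia.
- by apply: (cover_apart cov (a := a.+1) (c := c.+1)); lia.
- have [E|ne] := eqVneq a.+1 c; first by left; rewrite -E.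
  by right; apply: (cover_apart cov (a := a.+1)); lia.
- by right; apply: (cover_apart cov (a := c.+1)); lia.
Qed.

Lemma component_value_comp v w : same_comp D v w ->
  component_value v = component_value w.
Proof.
move=> vw; apply: eq_bigl => u; exact: (same_connect (@same_comp_sym _ _ D) vw).
Qed.

(** The lift is chosen such that the starting point, passed upwards, is on the
    first sheet; then it is rightmost among all lifted points. *)
Theorem circle_value v w : on_circle D v -> rightmost D v w ->
  component_value v = 2 * spin nu w.
Proof.
move=> Hv /andP[vw /forallP max]; rewrite (component_value_comp vw).
pose x := (w, true); pose e := ~~ is_up nu w.
have Hx : on_circle D x.1 by apply: contra Hv; apply: on_line_comp.
have [n [cov wn noend_n]] := circle_cover Hx.
have noend k : (k <= n)%N -> ~~ at_end D (walk D x k).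
  by rewrite leq_eqVlt => /predU1P[->|/(cover_end cov)].
pose p k := arrow_of nu e (walk D x k).
have -> : component_value w
    = (if e then 1 else -1) * \sum_(k < n.+1) rotation (p k) (p k.+1).
  rewrite -[w]/x.1 (component_value_walk e cov) big_ord_recr mulrDr /= -arrow_rotation //.
  by rewrite -[advance _ _]/(walk D x n.+1) wn -addrA [X in _ + X = _]addrC.
rewrite closed_rotation; first by rewrite mulrC /spin /e; case: is_up.
- by [].
- by rewrite /p wn.
- by [].
- by move=> k kn; apply: arrow_is_step; apply: noend.
- by move=> k /andP[k0 kn]; apply: arrow_apart; apply: (cover_apart cov); rewrite -?lt0n.
- move=> k _; have /implyP := max (walk D x k).1.
  move=> /(_ (connect_trans vw (same_comp_walk D x k))) le.
  rewrite /p !px_arrow {2}/sheet addbT eqxx /signed.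
  move: le; rewrite -[coord w.1]/(coord (walk D x 0).1.1).
  move: (coord _) (coord _) => a b.
  by case: sheet; lia.
move=> a c /andP[ac cn]; apply: arrow_exchange.
- by apply: noend; lia.
- by apply: noend; lia.
- by apply: (cover_apart cov); lia.
- rewrite -[advance _ _]/(walk D x a.+1) -[advance _ (walk D x c)]/(walk D x c.+1).
  have [->|ne] := eqVneq c n; first by rewrite wn; apply: (cover_apart cov (c := 0%N)); lia.
  by apply: (cover_apart cov); lia.
- have [E|ne] := eqVneq a.+1 c; first by left; rewrite -E.
  by right; apply: (cover_apart cov (a := a.+1)); lia.
- rewrite -[advance _ (walk D x c)]/(walk D x c.+1).
  have [->|ne] := eqVneq c n; last by right; apply: (cover_apart cov); lia.
  rewrite wn; case: a ac => [|a] ac; [by left|right].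
  by apply: (cover_apart cov (a := 0%N)); lia.
Qed.

Lemma end_ray x : at_end D x -> Ray x.1.1 (is_up nu x.1) \in layer D (ahead x).
Proof.
have /asboolP[_ _ bot top _] := valP nu.
case: x => [[i l] b]; rewrite /at_end /is_up /label /ahead /=.
case: b => /andP[/= /eqP El /existsP[d Hd]].
  have -> : l = ord_max by apply: val_inj.
  by rewrite (top _ _ Hd) addn1; case: d Hd.
have -> : l = ord0 by apply: val_inj.
by rewrite (bot _ _ Hd) addn0; case: d Hd.
Qed.

Lemma end_right_end x : at_end D x -> right_end_ahead D x = 0%N.
Proof.
move/end_ray/(mate_ray (HD _)) => E.
by rewrite /right_end_ahead (right_endsE (HD _)) E ltnn.
Qed.

(** In the outermost layer no lifted cup passes over a ray. *)
Lemma end_exposed e t s z x : at_end D z -> ~~ at_end D x ->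
  px s = signed t (coord z.1.1) -> py s = z.1.2 ->
  exposed (~~ z.2) s (arrow_of nu e x) (arrow_of nu e (advance D x)).
Proof.
move=> Hz Hx Epx Epy; rewrite /exposed Epx Epy negbK.
have Hr := end_ray Hz; apply/andP; split.
  rewrite !py_arrow; move: Hz; rewrite /at_end; case: z.2 => /andP[/eqP El _] /=.
    by rewrite El !lez_nat !leq_ord.
  by rewrite El.
apply/implyP => /andP[/andP[/eqP Eb1 /eqP Eb2] /eqP Ey].
rewrite arrow_dir in Eb1; rewrite py_arrow in Ey; rewrite arrow_dir in Eb2.
have Ea : ahead x = ahead z by case: Ey => Ey; rewrite /ahead Ey Eb1.
have {}Hr : has_ray (layer D (ahead x)) z.1.1.
  by rewrite Ea; apply/existsP; exists (is_up nu z.1).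
move: Eb2; rewrite !px_arrow.
case: (lifted_advanceP nu e Hx) => [k d Hk _ _ Es _ _|m _ _ _ _].
  by rewrite Es; apply: (lifted_cup_ray_noncrossing (HD _) _ _ Hk Hr).
by rewrite -[(_, m, _).2]/(x.2) Eb1; case: z.2.
Qed.

Definition end_count (b : bool) (v : vertex L h) : nat :=
  (\sum_(w | same_comp D v w) at_end D (w, b))%N.

Lemma end_count_cover b x n :
  at_end D (reverse x) -> covers D x n -> at_end D (walk D x n) ->
  end_count b x.1 = ((x.2 == ~~ b) + ((walk D x n).2 == b))%N.
Proof.
move=> Hx cov Hn; rewrite /end_count (big_comp _ _ cov) /=.
rewrite (eq_bigr (fun k : 'I_n.+1 => (k == 0%N :> nat) && (x.2 == ~~ b)
                    + (k == n :> nat) && ((walk D x n).2 == b)))%N; last first.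
  by move=> k _; apply: end_of_line => //; rewrite -ltnS.
rewrite big_split /= (bigD1 ord0) //= big1 ?addn0; last by case=> [[|k] ?].
rewrite [X in (_ + X)%N](bigD1 ord_max) //= eqxx big1 ?addn0 // => k.
by rewrite -val_eqE /= => /negbTE ->.
Qed.

Lemma end_count_circle b v : on_circle D v -> end_count b v = 0%N.
Proof.
move=> Hv; apply: big1 => w vw; apply/eqP; rewrite eqb0; apply: contra Hv.
by move/at_end_line; apply: on_line_comp.
Qed.

(** On the lift where wedges are passed upwards, a line with both ends at the
    bottom leads from a point to another one further to the right: the ends are
    two vees, lifted to opposite sheets, or a wedge and a vee, where the wedge
    belongs to a dotted ray and hence is on the left. So its tangent rotates by
    one clockwise half turn. The same holds at the top up to a rotation by one
    half turn. *)
Theorem line_value v : on_line D v ->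
  (end_count false v + end_count true v = 2)%N /\
  component_value v = (end_count false v != 1%N)%:Z.
Proof.
move=> /existsP[w /andP[vw Hw]].
have Ec b : end_count b v = end_count b w.
  by apply: eq_bigl => u; exact: (same_connect (@same_comp_sym _ _ D) vw).
rewrite (component_value_comp vw) !Ec.
pose x := (w, at_bottom_ray D w).
have Hx : at_end D (reverse x).
  rewrite /at_end [reverse x]/= [(_, _).2]/= [(_, _).1]/=.
  by case: (at_bottom_ray D w) Hw.
have [n cov Hn] := line_cover Hx.
rewrite -[w]/x.1 !(end_count_cover _ Hx cov Hn).
split; first by case: x.2; case: (walk D x n).2.
rewrite (component_value_walk false cov) !end_right_end // !mul0r !addr0.
pose p k := arrow_of nu false (walk D x k).
rewrite (@open_rotation n p).
- rewrite /p -/(walk D x 0); set y := walk D x n.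
  have Hd0 := end_ray Hx; have Hdn := end_ray Hn; rewrite -/y in Hdn Hn *.
  rewrite /beside !arrow_dir !px_arrow !py_arrow -[walk D x 0]/x mulN1r.
  have [E2|E2] := eqVneq x.2 y.2.
    by rewrite -E2 [X in X && _]eq_sym; case: x.2; rewrite subrr.
  have Eb : y.2 = ~~ x.2 by move: E2; case: x.2; case: y.2.
  have El : x.1.2 = y.1.2.
    apply: val_inj; move: Hx Hn; rewrite /at_end [(reverse x).2]/(~~ x.2) Eb.
    by case: x.2 => /andP[/eqP El _] /andP[/eqP El' _]; rewrite /= El'.
  have Ea : ahead (reverse x) = ahead y by rewrite /ahead Eb -El.
  rewrite Ea in Hd0; rewrite El Eb eqxx !andTb /sheet Eb.
  have Dx := dotted_ray_left_of_rays (HD _) (i := x.1.1) _ Hdn.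
  have Dy := dotted_ray_left_of_rays (HD _) (i := y.1.1) _ Hd0.
  have {}Dx : is_up nu x.1 -> ~~ (coord y.1.1 < coord x.1.1)%N.
    by move=> up; apply: Dx; rewrite up in Hd0.
  have {}Dy : is_up nu y.1 -> ~~ (coord x.1.1 < coord y.1.1)%N.
    by move=> up; apply: Dy; rewrite up in Hdn.
  have ne : coord x.1.1 != coord y.1.1.
    have n0 : 0%N != n by apply: contraNneq E2 => E; rewrite /y -E.
    apply: contra (cover_apart cov (leq0n n) (leqnn n) n0) => /eqP/coord_inj Exy.
    by rewrite -/y [_.1]surjective_pairing [y.1]surjective_pairing Exy El.
  have := coord_gt0 x.1.1; have := coord_gt0 y.1.1; move: Dx Dy ne.
  move: (coord x.1.1) (coord y.1.1) => a b; rewrite /signed; clear.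
  by case: (is_up _ _); case: (is_up _ _); case: x.2 => /= Dx Dy ne ? ?;
    try have {}Dx := Dx isT; try have {}Dy := Dy isT; lia.
- by move=> k kn; apply: arrow_is_step; apply: (cover_end cov).
- by move=> k /andP[k0 kn]; apply: arrow_apart; apply: (cover_apart cov); rewrite -?lt0n.
- move=> k kn; apply: arrow_apart.
  by apply: (cover_apart cov); rewrite ?(ltnW kn) // ltn_eqF.
- move=> k kn; rewrite -[(p 0%N).2]negbK.
  apply: (@end_exposed false (sheet nu false x) _ (reverse x)) => //.
  exact: (cover_end cov).
- move=> k kn.
  apply: (@end_exposed false (sheet nu false (walk D x n)) _ (walk D x n)) => //.
  exact: (cover_end cov).
- by move=> a c acn; apply: cover_exchange acn.
Qed.

End Value.

(** * The degree as a sum of values *)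

Section Degree.
Variables (L : block) (h : nat).

Lemma sum_arc_degree (lam : block_weight L) (c : {set diagram_arc (point L)}) :
  (forall i j d, Cup i j d \in c ->
     cup_degree d (wt_label lam i) (wt_label lam j) <> None) ->
  (\sum_(a in c) arc_degree lam a
   = \sum_i right_ends c i * (wt_label lam i == Down))%N.
Proof.
move=> ok; under [RHS]eq_bigr => i _.
  rewrite /right_ends -sum1_card big_distrl /=; under eq_bigl => a do rewrite inE.
  over.
rewrite (exchange_big_dep (mem c)) /=; last by move=> i a _ /andP[].
apply: eq_bigr => -[i j d|i d] ac /=; last by rewrite big_pred0 // => k; rewrite andbF.
rewrite (eq_bigl (pred1 j)) => [|k]; last by rewrite ac /= eq_sym.
rewrite big_pred1_eq mul1n; have := ok _ _ _ ac.
by case: d {ac}; case: (wt_label lam i); case: (wt_label lam j).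
Qed.

Variables (D : stacked L h) (nu : orientation D).

Lemma degree_right_ends :
  degree nu = (\sum_v right_end_count D v * (label nu v == Down))%N.
Proof.
have /asboolP[cups caps _ _ _] := valP nu.
rewrite -(pair_bigA _ (fun i l =>
  right_end_count D (i, l) * (label nu (i, l) == Down))%N) /=.
rewrite exchange_big; apply: eq_bigr => l _.
rewrite !sum_arc_degree; [|exact: caps|exact: cups].
rewrite -big_split; apply: eq_bigr => i _.
by rewrite /right_end_count /right_end_ahead /ahead /= addn0 addn1 mulnDl.
Qed.

Lemma degree_spin :
  (degree nu)%:Z *+ 2
  = \sum_v (right_end_count D v)%:Z * spin nu v + \sum_v (right_end_count D v)%:Z.
Proof.
rewrite degree_right_ends (big_morph Posz PoszD (erefl _)) -sumrMnl -big_split /=.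
apply: eq_bigr => v _; rewrite label_up /spin PoszM.
by case: is_up; rewrite ?mulr0 ?mul0rn ?mulrN1 ?addNr // !mulr1 mulr2n.
Qed.

End Degree.

(** * Surgery *)

Section ComponentPair.
Variables (L : block) (h : nat) (D : stacked L h).

(** The union of two components, which may coincide. *)
Definition in_pair (u v w : vertex L h) : bool := same_comp D u w || same_comp D v w.

Lemma big_in_pair (R : Type) (idx : R) (op : Monoid.com_law idx)
    (F : vertex L h -> R) u v :
  \big[op/idx]_(w | in_pair u v w) F w
  = if same_comp D u v then \big[op/idx]_(w | same_comp D v w) F w
    else op (\big[op/idx]_(w | same_comp D u w) F w)
            (\big[op/idx]_(w | same_comp D v w) F w).
Proof.
case: ifP => uv.
  apply: eq_bigl => w; rewrite /in_pair /same_comp.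
  by rewrite (same_connect (@same_comp_sym _ _ D) uv) orbb.
rewrite (bigID (same_comp D u)) /=; congr (op _ _); apply: eq_bigl => w; rewrite /in_pair.
  by case: (same_comp D u w); rewrite ?orbT ?andbF.
case uw: (same_comp D u w) => //=; last by rewrite andbT.
apply/esym/negbTE; apply: contraFN uv => vw.
rewrite /same_comp in uw vw *; rewrite (@same_comp_sym _ _ D) in vw.
exact: connect_trans uw vw.
Qed.

Lemma same_comp_closed (S : pred (vertex L h)) v w :
  (forall x y, adjacent D x y -> S x -> S y) ->
  same_comp D v w -> S v -> S w.
Proof.
move=> cl /connectP[q]; elim: q v => [|u q IH] v; first by move=> _ ->.
by case/andP=> vu uq E Sv; apply: IH uq E (cl _ _ vu Sv).
Qed.

Lemma in_pair_adjacent u v x y : adjacent D x y -> in_pair u v x -> in_pair u v y.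
Proof.
move=> xy /orP[H|H]; apply/orP; [left|right];
  exact: connect_trans H (connect1 xy).
Qed.

Variable nu : orientation D.

Lemma line_valueE v : on_line D v ->
  component_value nu v = (end_count D false v != 1%N)%:Z.
Proof. by case/(line_value nu). Qed.

Lemma end_count_sum v :
  (end_count D false v + end_count D true v = (on_line D v).*2)%N.
Proof.
have [Hl|Hl] := boolP (on_line D v); first by case: (line_value nu Hl).
by rewrite !(end_count_circle _ Hl).
Qed.

Lemma clockwise_value v : clockwise nu v ->
  ~~ on_line D v /\ component_value nu v = 2.
Proof.
case/andP=> Hc /existsP[w /andP[vw Hw]]; split=> //.
by rewrite (circle_value nu Hc vw) /spin /is_up (eqP Hw).
Qed.

Lemma anticlockwise_value v : anticlockwise nu v -> ~~ on_line D v ->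
  component_value nu v = -2.
Proof.
move=> + Hc; rewrite /anticlockwise (negbTE Hc) => /existsP[w /andP[vw Hw]].
by rewrite (circle_value nu Hc vw) /spin /is_up Hw.
Qed.

Lemma propagating_value v : on_propagating_line D v ->
  on_line D v /\ component_value nu v = 0.
Proof.
case/andP=> /existsP[w /andP[vw Hw]] /existsP[w' /andP[vw' Hw']].
have Hl : on_line D v by apply/existsP; exists w; rewrite vw Hw.
have has_end b u : same_comp D v u -> at_end D (u, b) -> (0 < end_count D b v)%N.
  by move=> vu Hu; rewrite /end_count (bigD1 u) //= Hu.
have := end_count_sum v; have := has_end false w vw Hw; have := has_end true w' vw' Hw'.
rewrite Hl line_valueE //; case: (end_count D false v) => [|[|n]] //.
by case: (end_count D true v) => // m; rewrite !addSn !addnS.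
Qed.

End ComponentPair.

Section Surgery.
Variables (L : block) (h : nat) (D D' : stacked L h).
Variables (l : 'I_h) (i j : point L).
Hypothesis surgered : is_surgery D D' l i j.

Let HD := layer_cup_diagram D.
Let HD' := layer_cup_diagram D'.
Let c := layer D l.+1.
Let c' := layer D' l.+1.

Let layerS (E : stacked L h) : layer E l.+1 = arcs_of (st_mid E l).
Proof. by rewrite /layer valK. Qed.

Let layer_off m : m != l.+1 -> layer D' m = layer D m.
Proof.
case: surgered => bot top mid _ _; case: m => [|m] ml; rewrite /layer ?bot //.
by case: insubP => [k _ Ek|_]; rewrite ?top // mid // -val_eqE Ek.
Qed.

Let lt_ij : (coord i < coord j)%N. Proof. by case: surgered. Qed.

Let cup_ij : exists2 d, Cup i j d \in c
  & c' = c :\ Cup i j d :|: [set Ray i false; Ray j false].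
Proof. by rewrite /c /c' !layerS; case: surgered. Qed.

Let mate_i : mate c i = j.
Proof. by have [d H _] := cup_ij; rewrite (mate_cupl (HD _) H). Qed.

Let mate_j : mate c j = i.
Proof. by have [d H _] := cup_ij; rewrite (mate_cupr (HD _) H). Qed.

Let mate'_i : mate c' i = i.
Proof.
have [d _ E] := cup_ij; apply: (mate_ray (HD' _) (d := false)).
by rewrite -/c' E !inE eqxx orbT.
Qed.

Let mate'_j : mate c' j = j.
Proof.
have [d _ E] := cup_ij; apply: (mate_ray (HD' _) (d := false)).
by rewrite -/c' E !inE eqxx !orbT.
Qed.

Let mate_off k : k != i -> k != j -> mate c' k = mate c k.
Proof.
move=> ki kj; have [d _ E] := cup_ij.
have sub a : a \in c -> on_arc k a -> a \in c'.
  move=> ac ka; rewrite E !inE ac andbT; apply/orP; left; apply: contraTneq ka => ->.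
  by rewrite /= negb_or ki kj.
case: (mateP (HD _) k) => [m e H _|m e H _|e H].
- by apply: (mate_cupl (HD' _) (d := e)); apply: sub; rewrite //= eqxx.
- by apply: (mate_cupr (HD' _) (d := e)); apply: sub; rewrite //= eqxx orbT.
- by apply: (mate_ray (HD' _) (d := e)); apply: sub; rewrite //= eqxx.
Qed.

Let bi := below l i. Let bj := below l j.
Let ai := above l i. Let aj := above l j.

Let touched (v : vertex L h) : bool := v \in [:: bi; bj; ai; aj].

Lemma mate_untouched v b : ~~ touched v ->
  mate (layer D' (ahead (v, b))) v.1 = mate (layer D (ahead (v, b))) v.1.
Proof.
move=> Hv; have [E|ne] := eqVneq (ahead (v, b)) l.+1; last by rewrite layer_off.
suff [vi vj] : v.1 != i /\ v.1 != j by rewrite E; apply: mate_off.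
case: v b Hv E => [k m] b; rewrite /touched !inE /bi /bj /ai /aj /below /above !xpair_eqE.
rewrite /ahead /= -!val_eqE /= !negb_or.
case: b => /=; rewrite /bump /=; rewrite ?addn1 ?addn0 => + E.
  by case: E => ->; rewrite eqxx !andbT => /and4P[].
by rewrite E !add1n eqxx !andbT => /and4P[].
Qed.

Lemma at_end_surgery x : at_end D' x = at_end D x.
Proof.
rewrite /at_end /at_top_ray /at_bottom_ray !layer_off //.
by rewrite eqSS gtn_eqF.
Qed.

Lemma advance_untouched x : ~~ touched x.1 -> advance D' x = advance D x.
Proof. by case: x => [[k m] b] Hx; rewrite /advance (mate_untouched _ Hx). Qed.

Lemma adjacent_untouched v w : v != w -> ~~ (touched v && touched w) ->
  adjacent D' v w = adjacent D v w.
Proof.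
move=> vw; wlog: v w vw / ~~ touched v.
  move=> H; rewrite negb_and => /orP[] Ht; first by apply: H; rewrite // negb_and Ht.
  rewrite (@adjacent_sym _ _ D') (@adjacent_sym _ _ D).
  by apply: H; rewrite // 1?eq_sym // negb_and Ht.
move=> Hv _; rewrite (adjacentP D' vw) (adjacentP D vw).
by apply: eq_existsb => b; rewrite advance_untouched.
Qed.

Let same_comp_advance' (E : stacked L h) x w : (advance E x).1 = w -> same_comp E x.1 w.
Proof. by move=> <-; apply: same_comp_advance. Qed.

Let ahead_below k : ahead ((below l k, true) : state L h) = l.+1.
Proof. by rewrite /ahead /= addn1. Qed.

Let ahead_above k : ahead ((above l k, false) : state L h) = l.+1.
Proof. by rewrite /ahead /= addn0 /bump. Qed.

Let ne_ij : j != i.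
Proof. by apply: contraTneq lt_ij => ->; rewrite ltnn. Qed.

Let bi_bj : same_comp D bi bj.
Proof.
apply: (same_comp_advance' (x := (bi, true))).
case: advanceP => [k|m|]; rewrite ahead_below -/c mate_i.
- by move=> ->.
- by move=> E; case/eqP: ne_ij; rewrite -E.
- by move=> E; case/eqP: ne_ij; rewrite -E.
Qed.

Let ai_aj : same_comp D ai aj.
Proof.
apply: (same_comp_advance' (x := (ai, false))).
case: advanceP => [k|m|]; rewrite ahead_above -/c mate_i.
- by move=> ->.
- by move=> E; case/eqP: ne_ij; rewrite -E.
- by move=> E; case/eqP: ne_ij; rewrite -E.
Qed.

Let below_above k : mate c' k = k -> same_comp D' (below l k) (above l k).
Proof.
move=> Hk; apply: (same_comp_advance' (x := (below l k, true))).
case: advanceP => [k'|m|]; rewrite ahead_below -/c' Hk.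
- by move=> ->; rewrite eqxx.
- by move=> _ Em _; rewrite /above; congr (_, _); apply: val_inj; rewrite /= Em.
- by move=> _ /andP[/= /eqP lh _]; have := ltn_ord l; rewrite lh ltnn.
Qed.

Let affected := in_pair D bi ai.

(** The two diagrams differ only in how the four vertices of the surgery are
    joined to each other, and all four belong to both sets. *)
Let affectedE v : affected v = in_pair D' ai aj v.
Proof.
have touchedE u : touched u -> affected u /\ in_pair D' ai aj u.
  have sym (E : stacked L h) x y : same_comp E x y = same_comp E y x :> bool.
    exact: (@same_comp_sym _ _ E).
  rewrite /touched !inE /affected /in_pair => /or4P[] /eqP ->.
  - by rewrite /same_comp connect0 -/(same_comp D' ai bi) sym below_above.
  - by rewrite bi_bj (sym _ aj) below_above ?orbT.
  - by rewrite /same_comp !connect0 orbT.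
  - by rewrite ai_aj orbT /same_comp !connect0 orbT.
have closed_transfer (E E' : stacked L h) (S : pred (vertex L h)) :
    (forall x y, x != y -> ~~ (touched x && touched y) ->
       adjacent E' x y = adjacent E x y) ->
    (forall u, touched u -> S u) ->
    (forall x y, adjacent E x y -> S x -> S y) ->
    forall x y, adjacent E' x y -> S x -> S y.
  move=> EE' QS cl x y xy Sx; have [<-//|ne] := eqVneq x y.
  have [/andP[_ /QS //]|nt] := boolP (touched x && touched y).
  by apply: cl Sx; rewrite -EE'.
have [tbi tbj tai taj] : [/\ touched bi, touched bj, touched ai & touched aj].
  split; rewrite /touched;
    [|apply: mem_behead|do 2 apply: mem_behead|do 3 apply: mem_behead];
    exact: mem_head.
have toD x y : adjacent D' x y -> affected x -> affected y.
  apply: closed_transfer x y => [x y|u /touchedE[] //|]; last exact: in_pair_adjacent.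
  exact: adjacent_untouched.
have toD' x y : adjacent D x y -> in_pair D' ai aj x -> in_pair D' ai aj y.
  apply: closed_transfer x y => [x y xy nt|u /touchedE[] //|]; last exact: in_pair_adjacent.
  by rewrite adjacent_untouched.
have [[ubi _] [_ ubi']] := (touchedE _ tbi, touchedE _ tbi).
have [uai uai'] := touchedE _ tai; have [uaj _] := touchedE _ taj.
apply/idP/idP => /orP[] H.
- exact: (same_comp_closed toD' H ubi').
- exact: (same_comp_closed toD' H uai').
- exact: (same_comp_closed toD H uai).
- exact: (same_comp_closed toD H uaj).
Qed.

Let right_ends_surgery k : right_ends c k = (right_ends c' k + (k == j))%N.
Proof.
rewrite (right_endsE (HD _)) (right_endsE (HD' _)) -/c -/c'.
have [->|kj] := eqVneq k j; first by rewrite mate_j mate'_j ltnn lt_ij.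
have [->|ki] := eqVneq k i; first by rewrite mate_i mate'_i ltnn ltnNge ltnW.
by rewrite mate_off // addn0.
Qed.

Let right_end_ahead_surgery x : right_end_ahead D x
  = (right_end_ahead D' x + ((x == (bj, true)) + (x == (aj, false))))%N.
Proof.
rewrite /right_end_ahead; have [E|ne] := eqVneq (ahead x) l.+1.
  rewrite E -/c -/c' right_ends_surgery; congr (_ + _)%N.
  case: x E => [[k m] b]; rewrite /ahead !xpair_eqE -!val_eqE /= /bump /= add1n.
  by case: b => /=; rewrite ?addn1 ?addn0 ?andbF ?andbT => -[->]; rewrite eqxx andbT ?addn0.
rewrite layer_off //; have -> : x == (bj, true) = false.
  by apply: contraNF ne => /eqP ->; rewrite ahead_below.
have -> : x == (aj, false) = false; last by rewrite !addn0.
by apply: contraNF ne => /eqP ->; rewrite ahead_above.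
Qed.

Let right_end_count_surgery v :
  right_end_count D v = (right_end_count D' v + ((v == bj) + (v == aj)))%N.
Proof.
rewrite /right_end_count !right_end_ahead_surgery !(xpair_eqE v) !andbT !andbF.
by rewrite !addn0 !add0n addnACA [((v == aj) + _)%N]addnC.
Qed.

Let bj_affected : affected bj. Proof. by rewrite /affected /in_pair bi_bj. Qed.
Let aj_affected : affected aj. Proof. by rewrite /affected /in_pair ai_aj orbT. Qed.

Variables (nu : orientation D) (nu' : orientation D').
Hypothesis agree : agree_off_surgery l i nu nu'.

Let label_off v : ~~ affected v -> is_up nu' v = is_up nu v.
Proof.
rewrite /affected /in_pair negb_or => /andP[/negbTE H1 /negbTE H2].
by have := forallP agree v; rewrite -/bi -/ai H1 H2 /is_up => /eqP ->.
Qed.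

Let value_on (E : stacked L h) (mu : orientation E) : int :=
  \sum_(v | affected v) (right_end_count E v)%:Z * spin mu v.

Let sum_counts (A : pred (vertex L h)) (g : vertex L h -> int) :
  \sum_(v | A v) (right_end_count D v)%:Z * g v
  = \sum_(v | A v) (right_end_count D' v)%:Z * g v
    + ((A bj)%:Z * g bj + (A aj)%:Z * g aj).
Proof.
have single u : \sum_(v | A v) (v == u)%:Z * g v = (A u)%:Z * g u.
  case: (boolP (A u)) => Au; last first.
    rewrite mul0r; apply: big1 => v Av.
    by case: eqP Av => // [->|_ _]; rewrite ?(negbTE Au) ?mul0r.
  rewrite (bigD1 u) //= eqxx big1 ?addr0 // => v /andP[_ /negbTE ->].
  exact: mul0r.
rewrite -!single -!big_split; apply: eq_bigr => v _ /=.
by rewrite right_end_count_surgery !PoszD !mulrDl.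
Qed.

(** The removed cup and cap account for the number 2: each of them contributes 1
    to the number of cups and caps in [degree_spin]. *)
Lemma degree_surgery : value_on nu' = value_on nu + 2 -> degree nu' = degree nu.
Proof.
move=> Hv; have E (a b : nat) : a%:Z *+ 2 = b%:Z *+ 2 -> a = b by lia.
apply: E; rewrite !degree_spin !(bigID affected predT) /=.
rewrite -/(value_on nu) -/(value_on nu') Hv.
have counts (A : pred (vertex L h)) : \sum_(v | A v) (right_end_count D v)%:Z
    = \sum_(v | A v) (right_end_count D' v)%:Z + ((A bj)%:Z + (A aj)%:Z).
  have E1 F : \sum_(v | A v) F v * 1 = \sum_(v | A v) F v :> int.
    by apply: eq_bigr => v _; rewrite mulr1.
  by have := sum_counts A (fun=> 1); rewrite !E1 !mulr1.
rewrite !counts bj_affected aj_affected.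
rewrite [X in _ + X + _ = _](eq_bigr
    (fun v => (right_end_count D v)%:Z * spin nu v)); last first.
  move=> v Hv'; rewrite /spin label_off // right_end_count_surgery.
  have -> : v == bj = false by apply: contraNF Hv' => /eqP ->.
  by have -> : v == aj = false by [apply: contraNF Hv' => /eqP ->]; rewrite !addn0.
rewrite /=; ring.
Qed.

Let value_before : value_on nu = if same_comp D bi ai then component_value nu ai
  else component_value nu bi + component_value nu ai.
Proof. exact: big_in_pair. Qed.

Let value_after : value_on nu' = if same_comp D' ai aj then component_value nu' aj
  else component_value nu' ai + component_value nu' aj.
Proof. by rewrite -big_in_pair; apply: eq_bigl => v; apply: affectedE. Qed.

(** A surgery does not touch the outermost layers, so it preserves ray ends. *)
Let end_count_balance b :
  ((if same_comp D bi ai then end_count D b ai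
    else end_count D b bi + end_count D b ai)
   = (if same_comp D' ai aj then end_count D' b aj
      else end_count D' b ai + end_count D' b aj))%N.
Proof.
rewrite -!big_in_pair; transitivity (\sum_(w | affected w) at_end D' (w, b))%N.
  by apply: eq_bigr => w _; rewrite at_end_surgery.
by apply: eq_bigl => v; apply: affectedE.
Qed.

Let merge_degree (R : realType) : same_comp D bi ai = false ->
  same_comp D' ai aj = true ->
  merge_coef R l i nu nu' != 0 -> degree nu' = degree nu.
Proof.
move=> Hs Hs'.
have comp' b : end_count D' b aj = end_count D' b ai.
  by apply: eq_bigl => w; rewrite /same_comp (same_connect (@same_comp_sym _ _ D') Hs').
have Ef := end_count_balance false; have Et := end_count_balance true.
have V := value_before; have V' := value_after.
rewrite Hs Hs' !comp' in Ef Et; rewrite Hs in V; rewrite Hs' in V'.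
rewrite -(component_value_comp nu' Hs') in V'.
have bal : ((on_line D bi).*2 + (on_line D ai).*2 = (on_line D' ai).*2)%N.
  rewrite -(end_count_sum nu' ai) -(end_count_sum nu bi) -(end_count_sum nu ai).
  by rewrite addnACA Ef Et.
rewrite /merge_coef -/bi -/ai => Hc; apply: degree_surgery; rewrite V V'; move: Hc.
case: ifP => [/andP[cb ca]|_].
  case c'a: (anticlockwise nu' ai); last by rewrite eqxx.
  move=> _; have [lb|lb] := boolP (on_line D bi); have [la|la] := boolP (on_line D ai).
  (* Two lines have four ray ends, but one component has at most two. *)
  - by move: bal; rewrite lb la; case: (on_line D' ai).
  - have l' : on_line D' ai by move: bal; rewrite lb (negbTE la); case: (on_line D' ai).
    rewrite (line_valueE nu lb) (line_valueE nu' l') (anticlockwise_value ca la) -Ef.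
    by rewrite (end_count_circle _ la) addn0 subrK.
  - have l' : on_line D' ai by move: bal; rewrite la (negbTE lb); case: (on_line D' ai).
    rewrite (line_valueE nu la) (line_valueE nu' l') (anticlockwise_value cb lb) -Ef.
    by rewrite (end_count_circle _ lb) add0n addrAC addNr add0r.
  - have l' : ~~ on_line D' ai.
      by move: bal; rewrite (negbTE la) (negbTE lb); case: (on_line D' ai).
    by rewrite (anticlockwise_value cb lb) (anticlockwise_value ca la)
      (anticlockwise_value c'a l').
case: ifP => [/andP[/clockwise_value[lb ->] ca]|_].
  case c'a: (clockwise nu' ai); last by rewrite mulr0 eqxx.
  have [l' ->] := clockwise_value c'a.
  have la : ~~ on_line D ai.
    by move: bal; rewrite (negbTE lb) (negbTE l'); case: (on_line D ai).
  by rewrite (anticlockwise_value ca la).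
case: ifP => [/andP[cb /clockwise_value[la ->]]|_]; last by rewrite eqxx.
case c'a: (clockwise nu' ai); last by rewrite mulr0 eqxx.
have [l' ->] := clockwise_value c'a.
have lb : ~~ on_line D bi.
  by move: bal; rewrite (negbTE la) (negbTE l'); case: (on_line D bi).
by rewrite (anticlockwise_value cb lb).
Qed.

(** Splitting off a clockwise circle of value 2 leaves a component of the kind and
    value of the original one. *)
Let split_value u v :
  end_count D false ai = (end_count D' false u + end_count D' false v)%N ->
  (on_line D ai).*2 = ((on_line D' u).*2 + (on_line D' v).*2)%N ->
  clockwise nu' u -> anticlockwise nu' v -> anticlockwise nu ai ->
  component_value nu' u + component_value nu' v = component_value nu ai + 2.
Proof.
move=> Ef bal /clockwise_value[lu ->] cv ca.
have [lv|lv] := boolP (on_line D' v).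
  have la : on_line D ai by move: bal; rewrite lv (negbTE lu); case: (on_line D ai).
  rewrite (line_valueE nu la) (line_valueE nu' lv) Ef (end_count_circle _ lu).
  by rewrite add0n addrC.
have la : ~~ on_line D ai.
  by move: bal; rewrite (negbTE lu) (negbTE lv); case: (on_line D ai).
by rewrite (anticlockwise_value cv lv) (anticlockwise_value ca la).
Qed.

Let split_degree (R : realType) : same_comp D bi ai = true ->
  same_comp D' ai aj = false ->
  split_coef R l i j nu nu' != 0 -> degree nu' = degree nu.
Proof.
move=> Hs Hs'.
have Ef := end_count_balance false; have Et := end_count_balance true.
have V := value_before; have V' := value_after.
rewrite Hs Hs' in Ef Et; rewrite Hs in V; rewrite Hs' in V'.
have bal : (on_line D ai).*2 = ((on_line D' ai).*2 + (on_line D' aj).*2)%N.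
  rewrite -(end_count_sum nu ai) -(end_count_sum nu' ai) -(end_count_sum nu' aj).
  by rewrite addnACA Ef Et.
rewrite /split_coef -/ai -/aj => Hc; apply: degree_surgery; rewrite V V'; move: Hc.
case: ifP => [ca|_].
  have [/andP[cj c'i] _|_] := boolP (clockwise nu' aj && anticlockwise nu' ai).
    rewrite addrC; apply: split_value => //; first by rewrite addnC.
    by rewrite addnC.
  have [/andP[ci c'j] _|_] := boolP (clockwise nu' ai && anticlockwise nu' aj).
    exact: split_value.
  by rewrite !mulr0 addr0 mulr0 eqxx.
case: ifP => [/clockwise_value[_ ->]|_]; last by rewrite mulr0 eqxx.
have [/andP[/clockwise_value[_ ->] /clockwise_value[_ ->]] //|_] :=
  boolP (clockwise nu' ai && clockwise nu' aj).
by rewrite !mulr0 eqxx.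
Qed.

Let reconnect_degree (R : realType) : same_comp D bi ai = false ->
  same_comp D' ai aj = false ->
  reconnect_coef R l i nu nu' != 0 -> degree nu' = degree nu.
Proof.
move=> Hs Hs'; rewrite /reconnect_coef -/bi -/ai.
case: (boolP [&& _, _ & _]) => [/and3P[/eqP Enu Pb Pa] _|]; last by rewrite eqxx.
have Ef := end_count_balance false; have Et := end_count_balance true.
have V := value_before; have V' := value_after.
rewrite Hs Hs' in Ef Et; rewrite Hs in V; rewrite Hs' in V'.
have [lb Vb] := propagating_value nu Pb; have [la Va] := propagating_value nu Pa.
have bal : ((on_line D' ai).*2 + (on_line D' aj).*2 = 4)%N.
  rewrite -(end_count_sum nu' ai) -(end_count_sum nu' aj) addnACA -Ef -Et addnACA.
  rewrite (end_count_sum nu bi) (end_count_sum nu ai).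
  by rewrite lb la.
have [li lj] : on_line D' ai /\ on_line D' aj.
  by move: bal; case: (on_line D' ai); case: (on_line D' aj).
rewrite Vb Va addr0 in V; rewrite (line_valueE nu' li) (line_valueE nu' lj) in V'.
have spinE v : spin nu' v = spin nu v by rewrite /spin /is_up /label Enu.
have glue : spin nu bj = spin nu aj.
  rewrite -!spinE /spin; congr (if _ then _ else _).
  apply: (ray_labels nu'); first by rewrite /= /bump.
  by rewrite (has_rayE (HD' _)) /= /bump add1n -/c' mate'_j.
have VV : value_on nu = value_on nu' + (spin nu bj + spin nu aj).
  rewrite /value_on sum_counts bj_affected aj_affected !mul1r; congr (_ + _).
  by apply: eq_bigr => v _; rewrite spinE.
(* As the labels are kept, the value changes by twice a spin; it starts from 0
   and cannot become negative, so it grows by 2. *)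
apply: degree_surgery; rewrite V add0r; move: VV; rewrite V V' glue /spin.
by case: is_up; case: eqP => _; case: eqP.
Qed.

Theorem surgery_degree (R : realType) :
  surg_coef R l i j nu nu' != 0 -> degree nu' = degree nu.
Proof.
rewrite /surg_coef agree /= -/bi -/ai -/aj.
case Hs : (same_comp D bi ai); case Hs' : (same_comp D' ai aj).
- by rewrite eqxx.
- exact: split_degree.
- exact: merge_degree.
- exact: reconnect_degree.
Qed.

End Surgery.

Theorem proposition5p19 (R : realType) (L : block) (h : nat)
    (D D' : stacked L h) (l : 'I_h) (i j : point L) :
  is_surgery D D' l i j ->
  homogeneous_of_degree_zero (@surg R L h D D' l i j).
Proof.
move=> Hs d x Hx nu'; rewrite /surg /= sum_ffunE => Hsum.
have [nu xc] : exists nu, x nu * surg_coef R l i j nu nu' != 0.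
  apply/existsP; apply: contraNT Hsum; rewrite negb_exists => /forallP H.
  rewrite big1 // => nu _; rewrite !ffunE; apply/eqP.
  by have := H nu; rewrite negbK.
move: xc; rewrite mulf_eq0 negb_or => /andP[xnu coef].
have agree : agree_off_surgery l i nu nu'.
  by apply: contraNT coef; rewrite /surg_coef => ->.
by rewrite -(Hx nu xnu) (surgery_degree Hs agree coef).
Qed.
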